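(* $e^-$-\textsc{Longest Path} and $v^-$-\textsc{Longest Path} do not have polynomial kernels unless $\mathrm{NP}\subseteq\mathrm{coNP}/\mathrm{poly}$.
   Context: \textsc{Longest Path}: given a graph $G$ and $k$, decide whether $G$ contains a path of length at least $k$ (parameter $k$; a maximization problem). Local modifications: $G-e$ deletes an edge $e$; $G-v$ deletes a vertex $v$ and its incident edges. For $\mathrm{lm}\in\{e^-,v^-\}$, an instance of $\mathrm{lm}$-\textsc{Longest Path} is $((G,k),s,(G_{\mathrm{lm}},k'))$ where $s$ is a path of length at least $k$ in $G$ if one exists and $s=\bot$ otherwise, $G_{\mathrm{lm}}$ is the modified graph and $k'\ge k$; it is a yes-instance iff $(G_{\mathrm{lm}},k')$ is a yes-instance of \textsc{Longest Path}. A polynomial kernel for such an instance is an instance of \textsc{Longest Path}, computed in polynomial time, equivalent to $(G_{\mathrm{lm}},k')$, with size and parameter bounded by a polynomial in the parameter. *)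

(* Defs.v *)
From mathcomp Require Import all_boot all_order all_algebra.

Set Implicit Arguments.
Unset Strict Implicit.
Unset Printing Implicit Defensive.

(** * Multi-tape Turing machines *)

Notation bits := (seq bool).

Definition cell (aux : finType) : finType := option (bool + aux).

Definition bit_cell (aux : finType) (b : bool) : cell aux := Some (inl b).

(** A two-way infinite tape: the cells to the left of the head (nearest first),
    the scanned cell, and the cells from there to the right.  All the cells that
    are not listed are blank ([None]). *)
Record tape (aux : finType) := Tape {
  tape_left : seq (cell aux);
  tape_head : cell aux;
  tape_right : seq (cell aux)
}.

Inductive move := MoveLeft | Stay | MoveRight.

Definition move_tape (aux : finType) (m : move) (t : tape aux) : tape aux :=
  match m with
  | MoveLeft => Tape (behead (tape_left t)) (head None (tape_left t))
                     (tape_head t :: tape_right t)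
  | Stay => t
  | MoveRight => Tape (tape_head t :: tape_left t) (head None (tape_right t))
                      (behead (tape_right t))
  end.

Definition write_tape (aux : finType) (c : cell aux) (t : tape aux) : tape aux :=
  Tape (tape_left t) c (tape_right t).

Definition word_tape (aux : finType) (w : bits) : tape aux :=
  Tape [::] (head None (map (@bit_cell aux) w)) (behead (map (@bit_cell aux) w)).

Fixpoint leading_bits (aux : finType) (s : seq (cell aux)) : bits :=
  if s is Some (inl b) :: s' then b :: leading_bits s' else [::].

(** The word on a tape is the maximal block of bits that starts at the head. *)
Definition tape_word (aux : finType) (t : tape aux) : bits :=
  leading_bits (tape_head t :: tape_right t).

(** A deterministic machine with [tm_tapes.+1] tapes: the first one holds the
    input, the last one the output.  The alphabet is {0, 1, blank} together with
    the auxiliary symbols [tm_aux]. *)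
Record tm := TM {
  tm_aux : finType;
  tm_state : finType;
  tm_tapes : nat;
  tm_start : tm_state;
  tm_halt : pred tm_state;
  tm_trans : tm_state -> {ffun 'I_tm_tapes.+1 -> cell tm_aux} ->
             tm_state * ('I_tm_tapes.+1 -> cell tm_aux * move)
}.

Record config (M : tm) := Config {
  conf_state : tm_state M;
  conf_tape : 'I_(tm_tapes M).+1 -> tape (tm_aux M)
}.

Definition tm_init (M : tm) (w : bits) : config M :=
  Config (tm_start M) (fun i => word_tape (tm_aux M) (if i == ord0 then w else [::])).

Definition tm_halted (M : tm) (c : config M) : bool := tm_halt (conf_state c).

(** A halting configuration is its own successor. *)
Definition tm_step (M : tm) (c : config M) : config M :=
  if tm_halted c then c else
  let: (q, act) := tm_trans (conf_state c)
                     [ffun i => tape_head (conf_tape c i)] in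
  Config q (fun i => move_tape (act i).2 (write_tape (act i).1 (conf_tape c i))).

Definition tm_output (M : tm) (c : config M) : bits :=
  tape_word (conf_tape c ord_max).

(** [f] is computed in polynomial time, its argument and its value being
    written as words by means of [encA] and [encB]. *)
Definition poly_time (A B : Type) (encA : A -> bits) (encB : B -> bits)
    (f : A -> B) : Prop :=
  exists (M : tm) (p : {poly nat}), forall x : A,
    let c := iter (p.[size (encA x)])%R (@tm_step M) (tm_init M (encA x)) in
    tm_halted c /\ tm_output c = encB (f x).

(** * The classes NP, coNP and coNP/poly *)

Definition language := bits -> Prop.

Definition enc_bool (b : bool) : bits := [:: b].

(** Each bit of the first word is preceded by a 1; a 0 marks its end. *)
Definition enc_pair (xy : bits * bits) : bits :=
  flatten [seq [:: true; b] | b <- xy.1] ++ false :: xy.2.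

Definition NP (L : language) : Prop :=
  exists (R : bits * bits -> bool) (p : {poly nat}),
    poly_time enc_pair enc_bool R /\
    forall x, L x <-> exists w : bits, (size w <= (p.[size x])%R) /\ R (x, w).

Definition coNP (L : language) : Prop := NP (fun x => ~ L x).

Definition coNP_poly (L : language) : Prop :=
  exists (L' : language) (advice : nat -> bits) (p : {poly nat}),
    [/\ coNP L',
        forall n, size (advice n) <= (p.[n])%R
      & forall x, L x <-> L' (enc_pair (x, advice (size x)))].

(** * Graphs, paths and local modifications *)

(** A finite simple undirected graph with vertex set [{0, ..., nverts - 1}]. *)
Record graph := Graph {
  nverts : nat;
  edges : {set {set 'I_nverts}};
  edges_card2 : [forall e in edges, #|e| == 2]
}.

Definition adj (G : graph) : rel 'I_(nverts G) :=
  fun x y => [set x; y] \in edges G.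

(** A path is given by the nonempty sequence of its vertices; its length is the
    number of its edges. *)
Definition is_path (G : graph) (s : seq 'I_(nverts G)) : bool :=
  if s is x :: p then path (@adj G) x p && uniq s else false.

Definition path_length (G : graph) (s : seq 'I_(nverts G)) : nat := (size s).-1.

Lemma delete_edge_card2 (G : graph) (e : {set 'I_(nverts G)}) :
  [forall f in edges G :\ e, #|f| == 2].
Proof.
apply/forall_inP => f /setD1P[_ fG].
exact: (forall_inP (edges_card2 G)).
Qed.

Definition delete_edge (G : graph) (e : {set 'I_(nverts G)}) : graph :=
  Graph (delete_edge_card2 e).

Lemma delete_vertex_card2 (G : graph) (v : 'I_(nverts G)) :
  [forall f in [set f : {set 'I_(nverts G).-1} | lift v @: f \in edges G],
     #|f| == 2].
Proof.
apply/forall_inP => f; rewrite inE => fG.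
rewrite -(card_imset _ (@lift_inj _ v)).
exact: (forall_inP (edges_card2 G)).
Qed.

(** The remaining vertices are renumbered in increasing order: [lift v] is the
    increasing bijection from [{0, ..., nverts - 2}] onto the vertices other
    than [v]. *)
Definition delete_vertex (G : graph) (v : 'I_(nverts G)) : graph :=
  Graph (delete_vertex_card2 v).

Inductive modification := EdgeDeletion | VertexDeletion.

Definition modified (lm : modification) (G H : graph) : Prop :=
  match lm with
  | EdgeDeletion => exists2 e, e \in edges G & H = delete_edge e
  | VertexDeletion => exists v : 'I_(nverts G), H = delete_vertex v
  end.

(** * Longest Path and its reoptimization variants *)

Definition lp_instance : Type := graph * nat.

Definition lp_solution (G : graph) (k : nat) (s : seq 'I_(nverts G)) : bool :=
  is_path s && (k <= path_length s).

Definition lp_yes (I : lp_instance) : Prop :=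
  exists s : seq 'I_(nverts I.1), lp_solution I.2 s.

(** [None] claims that there is no solution. *)
Definition correct_answer (G : graph) (k : nat)
    (s : option (seq 'I_(nverts G))) : Prop :=
  match s with
  | Some s' => lp_solution k s'
  | None => ~ lp_yes (G, k)
  end.

Record reopt_instance (lm : modification) := ReoptInstance {
  old_graph : graph;
  old_param : nat;
  old_solution : option (seq 'I_(nverts old_graph));
  new_graph : graph;
  new_param : nat;
  old_solutionP : correct_answer old_param old_solution;
  new_graphP : modified lm old_graph new_graph;
  new_paramP : old_param <= new_param
}.

Definition reopt_yes (lm : modification) (I : reopt_instance lm) : Prop :=
  lp_yes (new_graph I, new_param I).

(** Every code below is prefix-free, so that concatenated codes can be
    separated again.  The parameters are written in unary. *)
Definition enc_nat (n : nat) : bits := rcons (nseq n true) false.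

(** The number of vertices, then the adjacency matrix. *)
Definition enc_graph (G : graph) : bits :=
  enc_nat (nverts G) ++ [seq adj x y | x <- enum 'I_(nverts G), y <- enum 'I_(nverts G)].

Definition enc_vertices (n : nat) (s : seq 'I_n) : bits :=
  enc_nat (size s) ++ flatten [seq enc_nat x | x : 'I_n <- s].

Definition enc_solution (n : nat) (s : option (seq 'I_n)) : bits :=
  if s is Some s' then true :: enc_vertices s' else [:: false].

Definition enc_lp (I : lp_instance) : bits := enc_graph I.1 ++ enc_nat I.2.

Definition enc_reopt (lm : modification) (I : reopt_instance lm) : bits :=
  enc_lp (old_graph I, old_param I) ++ enc_solution (old_solution I) ++
  enc_lp (new_graph I, new_param I).

(** The parameter of a reoptimization instance is that of its new
    instance, which bounds the parameter of the old one. *)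
Definition has_poly_kernel (lm : modification) : Prop :=
  exists (K : reopt_instance lm -> lp_instance) (q : {poly nat}),
    poly_time (@enc_reopt lm) enc_lp K /\
    forall I : reopt_instance lm,
      [/\ lp_yes (K I) <-> reopt_yes I,
          size (enc_lp (K I)) <= (q.[new_param I])%R
        & (K I).2 <= (q.[new_param I])%R].

(* Main.v *)
Require Import Defs.
From mathcomp Require Import all_boot all_order all_algebra.
From mathcomp Require Import zify.
From Stdlib Require Import Classical IndefiniteDescription.

Set Implicit Arguments.
Unset Strict Implicit.
Unset Printing Implicit Defensive.

(** Let [L] be in NP.  By the Cook-Levin tableau and the classical reduction from
    SAT to Hamiltonian path, membership of a word [x] of length [n] in [L] amounts
    to the existence of a path of length [k], polynomial in [n], in a graph whose
    adjacency matrix consists of constants and of literals of the bits of [x].  The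
    disjoint union of [t] such graphs, together with two new vertices, is the new
    graph of a reoptimization instance with the parameter [k]: the old graph has an
    additional edge between the new vertices, or is the whole graph before one of
    them is deleted, and a single new vertex is a path of length 0.  A kernel maps
    this instance to a word of length at most [m], polynomial in [k]; so
    [t = m + 1] words are distilled into fewer than [2 ^ t] values, and, as in the
    theorem of Fortnow and Santhanam, [n + 1] pairs (position, value) witness that
    the words of length [n] outside [L] are outside [L].  The computation of the
    kernel on an instance of known length is in turn described by a tableau, whose
    input is again made of constants and literals.  Hence non-membership is
    expressed by CNFs of polynomial size; they are the advice, and the only machine
    that has to be built is one that evaluates a given CNF. *)

(** * Polynomially bounded functions *)

(** The old solution carries no information since the old parameter is 0, and the union expresses a
    disjunction because a path of positive length stays in one component. The kernel size is bounded
    in [k] alone, and [k] does not grow with the number of composed words; hence this number may be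
    chosen after the kernel size. The certificates are sound because a stored value is the kernel of
    a union of words outside [L], a no-instance, whereas a union that includes a member of [L] is a
    yes-instance; so the companions of the tested word are guessed without being checked. Each
    stored pair removes at least half of the words still uncovered, of which there are at most
    [2 ^ n]. No reduction is programmed: a composed instance merely copies input bits up to negation
    and can be fed to a tableau directly. Only the existence of small formulas for each length is
    tracked, because the advice supplies them. *)

Lemma leq_horner (p : {poly nat}) (m n : nat) :
  m <= n -> ((p.[m])%R <= (p.[n])%R)%N.
Proof.
move=> le_mn; rewrite !horner_coef; apply: leq_sum => i _.
apply: leq_mul => //; elim: (nat_of_ord i) => // j IHj.
by rewrite !GRing.exprS; apply: leq_mul.
Qed.

Definition poly_bounded (f : nat -> nat) : Prop :=
  exists p : {poly nat}, forall n, f n <= (p.[n])%R.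

Lemma poly_bounded_le (f g : nat -> nat) :
  (forall n, f n <= g n) -> poly_bounded g -> poly_bounded f.
Proof. by move=> fg [p gp]; exists p => n; apply: leq_trans (gp n). Qed.

Lemma poly_bounded_const (c : nat) : poly_bounded (fun => c).
Proof. by exists (c%:P)%R => n; rewrite hornerC. Qed.

Lemma poly_bounded_id : poly_bounded id.
Proof. by exists ('X)%R => n; rewrite hornerX. Qed.

Lemma poly_bounded_add (f g : nat -> nat) :
  poly_bounded f -> poly_bounded g -> poly_bounded (fun n => f n + g n).
Proof.
by move=> [p fp] [q gq]; exists (p + q)%R => n; rewrite hornerD; apply: leq_add.
Qed.

Lemma poly_bounded_mul (f g : nat -> nat) :
  poly_bounded f -> poly_bounded g -> poly_bounded (fun n => f n * g n).
Proof.
by move=> [p fp] [q gq]; exists (p * q)%R => n; rewrite hornerM; apply: leq_mul.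
Qed.

Lemma poly_bounded_succ (f : nat -> nat) :
  poly_bounded f -> poly_bounded (fun n => (f n).+1).
Proof.
move=> pf; apply: poly_bounded_le (poly_bounded_add pf (poly_bounded_const 1)) => n.
by rewrite addn1.
Qed.

Lemma poly_bounded_horner (p : {poly nat}) (f : nat -> nat) :
  poly_bounded f -> poly_bounded (fun n => (p.[f n])%R).
Proof.
move=> [q fq]; exists (p \Po q)%R => n.
by rewrite horner_comp; apply: leq_horner.
Qed.

Lemma poly_bounded_exp (f : nat -> nat) (d : nat) :
  poly_bounded f -> poly_bounded (fun n => f n ^ d).
Proof.
move=> pf; elim: d => [|d IHd]; first exact: poly_bounded_const.
by apply: poly_bounded_le (poly_bounded_mul pf IHd) => n; rewrite expnS.
Qed.

Ltac poly_bound := repeat first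
  [ assumption | apply: poly_bounded_const | exact: poly_bounded_id
  | apply: poly_bounded_horner | apply: poly_bounded_exp | apply: poly_bounded_succ
  | apply: poly_bounded_add | apply: poly_bounded_mul ].

(** * Predicates on words defined by existentially quantified CNFs *)

Definition lit : Type := nat * bool.
Definition cnf : Type := seq (seq lit).

Definition sat_lit (u : bits) (l : lit) : bool := nth false u l.1 == l.2.

Definition sat (u : bits) (f : cnf) : bool := all (has (sat_lit u)) f.

Definition cnf_size (f : cnf) : nat := sumn [seq (size c).+1 | c <- f].

Definition cnf_bounded (v : nat) (f : cnf) : bool :=
  all (all (fun l : lit => l.1 < v)) f.

(** This is nondeterministic computation without uniformity: some formula has to exist for the
    length [n], and nothing is said about finding it. [B] bounds the auxiliary variables along with
    the size, since both enter the length of the advice. *)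
Definition cnf_def (n B : nat) (P : bits -> Prop) : Prop :=
  exists r f, [/\ r + cnf_size f <= B, cnf_bounded (n + r) f
    & forall x, size x = n -> (P x <-> exists2 w, size w = r & sat (x ++ w) f)].

Lemma cnf_def_le (n B B' : nat) (P : bits -> Prop) :
  B <= B' -> cnf_def n B P -> cnf_def n B' P.
Proof.
by move=> le_BB' [r [f [rB fb Pf]]]; exists r, f; split=> //; apply: leq_trans le_BB'.
Qed.

Lemma cnf_def_iff (n B : nat) (P Q : bits -> Prop) :
  (forall x, size x = n -> (P x <-> Q x)) -> cnf_def n B P -> cnf_def n B Q.
Proof.
move=> PQ [r [f [rB fb Pf]]]; exists r, f; split=> // x szx.
by rewrite -PQ // Pf.
Qed.

Lemma sat_cat (u : bits) (f g : cnf) : sat u (f ++ g) = sat u f && sat u g.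
Proof. exact: all_cat. Qed.

Lemma cnf_size_cat (f g : cnf) : cnf_size (f ++ g) = cnf_size f + cnf_size g.
Proof. by rewrite /cnf_size map_cat sumn_cat. Qed.

Lemma cnf_size_flatten (T : Type) (F : T -> cnf) (s : seq T) (b : nat) :
  (forall j, cnf_size (F j) <= b) ->
  cnf_size (flatten [seq F j | j <- s]) <= size s * b.
Proof.
move=> Fb; elim: s => //= j s IHs.
by rewrite cnf_size_cat mulSn leq_add.
Qed.

Lemma cnf_def_ex (n l B : nat) (P : bits -> Prop) :
  cnf_def (n + l) B P ->
  cnf_def n (B + l) (fun x => exists2 u, size u = l & P (x ++ u)).
Proof.
move=> [r [f [rB fb Pf]]]; exists (l + r), f; split.
- by rewrite -addnA addnC leq_add2r.
- by rewrite addnA.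
move=> x szx; split=> [[u szu]|[w szw satw]].
  rewrite Pf ?size_cat ?szx ?szu // => -[w szw satw].
  by exists (u ++ w); rewrite ?catA // size_cat szu szw.
have szu: size (take l w) = l by rewrite size_takel // szw leq_addr.
exists (take l w) => //; rewrite Pf ?size_cat ?szx ?szu //.
exists (drop l w); first by rewrite size_drop szw addKn.
by rewrite -catA cat_take_drop.
Qed.

Section Disjunction.

Variables (n J B : nat) (r : nat -> nat) (f : nat -> cnf).
Hypothesis rB : forall j, r j + cnf_size (f j) <= B.
Hypothesis fb : forall j, cnf_bounded (n + r j) (f j).

Let shift (l : lit) : lit := (if l.1 < n then l.1 else l.1 + J, l.2).

(* The variables [n + j] with [j < J] select a disjunct; the disjuncts share the
   remaining ones. *)
Let branch (j : nat) : cnf := [seq (n + j, false) :: map shift c | c <- f j].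

Let disj : cnf :=
  [seq (n + j, true) | j <- iota 0 J] :: flatten [seq branch j | j <- iota 0 J].

Let nth_shift (x s w : bits) (l : lit) : size x = n -> size s = J ->
  sat_lit (x ++ s ++ w) (shift l) = sat_lit (x ++ w) l.
Proof.
move=> szx szs; rewrite /sat_lit /shift /= !nth_cat szx szs.
case: (ltnP l.1 n) => [->//|le_nl]; have -> : (l.1 + J < n) = false by lia.
have -> : (l.1 + J - n < J) = false by lia.
by congr (nth _ _ _ == _); lia.
Qed.

Let sat_ext (v : nat) (u u' : bits) (g : cnf) : cnf_bounded v g ->
  (forall i, i < v -> nth false u i = nth false u' i) -> sat u g = sat u' g.
Proof.
move=> gb uu'; apply: eq_in_all => c cg; apply: eq_in_has => l lc.
by rewrite /sat_lit uu' //; move/allP: gb => /(_ c cg)/allP/(_ l lc).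
Qed.

Let size_branch j : cnf_size (branch j) <= 2 * cnf_size (f j).
Proof.
rewrite /branch; elim: (f j) => //= c g IHg.
by rewrite /cnf_size /= size_map mulnDr leq_add //; lia.
Qed.

(** A branch that is not selected is satisfied by its selector literal, so the formula stays a CNF.
    The cost is [J + B] variables, [J + 1] for the selecting clause and [2 * B] per branch, as one
    more literal at most doubles the size of a clause. *)
Lemma cnf_def_or (P : nat -> bits -> Prop) :
  (forall j, j < J -> forall x, size x = n ->
     (P j x <-> exists2 w, size w = r j & sat (x ++ w) (f j))) ->
  cnf_def n ((J + 1) * (3 * B + 3)) (fun x => exists2 j, j < J & P j x).
Proof.
move=> Pf; exists (J + B), disj; split.
- have: cnf_size (flatten [seq branch j | j <- iota 0 J]) <= J * (2 * B).
    rewrite -{2}(size_iota 0 J); apply: cnf_size_flatten => j.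
    by apply: leq_trans (size_branch j) _; have := rB j; lia.
  rewrite /disj /cnf_size /= size_map size_iota -/(cnf_size _); nia.
- rewrite /cnf_bounded /=; apply/andP; split.
    by apply/allP => _ /mapP[j + ->] /=; rewrite mem_iota; lia.
  apply/allP => c /flattenP[_ /mapP[j + ->]] /mapP[c' c'f ->].
  rewrite mem_iota => jJ /=; apply/andP; split; first by lia.
  apply/allP => _ /mapP[l lc ->] /=.
  move/allP: (fb j) => /(_ c' c'f)/allP/(_ l lc).
  by have := rB j; case: ifP; lia.
move=> x szx; split=> [[j jJ]|[sw szsw]].
  rewrite Pf // => -[w szw satw].
  pose s := mkseq (fun i => i == j) J.
  have szs : size s = J by rewrite size_mkseq.
  have rjB : r j <= B by have := rB j; lia.
  exists (s ++ w ++ nseq (B - r j) false).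
    by rewrite !size_cat size_nseq szs szw; lia.
  have sel i : i < J -> nth false (x ++ s ++ w ++ nseq (B - r j) false) (n + i) = (i == j).
    move=> iJ; rewrite nth_cat szx ltnNge leq_addr /= addKn nth_cat szs iJ.
    by rewrite nth_mkseq.
  rewrite /disj /sat /=; apply/andP; split.
    apply/hasP; exists (n + j, true); first by apply: map_f; rewrite mem_iota.
    by rewrite /sat_lit /= sel // eqxx.
  apply/allP => c /flattenP[_ /mapP[i + ->]] /mapP[c' c'f ->].
  rewrite mem_iota /= => iJ; rewrite {1}/sat_lit /= sel //.
  case: (eqVneq i j) => //= eq_ij; rewrite {i iJ}eq_ij in c'f *.
  rewrite has_map (eq_has (fun l => nth_shift _ l szx szs)).
  have /allP/(_ c' c'f) // : sat (x ++ w ++ nseq (B - r j) false) (f j).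
  rewrite (sat_ext (u' := x ++ w) (fb j)) // => i ilt.
  by rewrite catA nth_cat size_cat szx szw ilt.
rewrite /disj /sat /= => /andP[/hasP[_ /mapP[j + ->]]].
rewrite mem_iota add0n /= => jJ selj /allP satj.
exists j => //; rewrite Pf //.
have rjB : r j <= B by have := rB j; lia.
have szs : size (take J sw) = J by rewrite size_takel // szsw leq_addr.
pose w := drop J sw; exists (take (r j) w).
  by rewrite size_takel // size_drop szsw; lia.
rewrite -(sat_ext (u := x ++ w) (fb j)).
  apply/allP => c cf; move: (satj ((n + j, false) :: map shift c)).
  rewrite -(cat_take_drop J sw) -/w /= {1}/sat_lit /=.
  rewrite -(cat_take_drop J sw) -/w /sat_lit /= in selj; rewrite (eqP selj) /=.
  rewrite has_map (eq_has (fun l => nth_shift _ l szx szs)); apply.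
  apply/flattenP; exists (branch j); first by apply: map_f; rewrite mem_iota.
  by apply/mapP; exists c.
move=> i ilt; rewrite !nth_cat szx; case: ltnP => // ni.
by rewrite nth_take //; lia.
Qed.

End Disjunction.

Lemma cnf_def_exists_lt (n J B : nat) (P : nat -> bits -> Prop) :
  (forall j, j < J -> cnf_def n B (P j)) ->
  cnf_def n ((J + 1) * (3 * B + 3)) (fun x => exists2 j, j < J & P j x).
Proof.
move=> Pdef.
have /functional_choice[g gP] : forall j, exists rf : nat * cnf,
    [/\ rf.1 + cnf_size rf.2 <= B, cnf_bounded (n + rf.1) rf.2
    & j < J -> forall x, size x = n ->
      (P j x <-> exists2 w, size w = rf.1 & sat (x ++ w) rf.2)].
  move=> j; case: (ltnP j J) => [/Pdef[r [f [rB fb Pf]]]|_].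
    by exists (r, f).
  (* Beyond [J] any pair within the bounds will do. *)
  by exists (0, [::]).
apply: (@cnf_def_or n J B (fun j => (g j).1) (fun j => (g j).2)) => j.
- by case: (gP j).
- by case: (gP j).
by case: (gP j).
Qed.

(** * Tapes in head-relative coordinates *)

(** In coordinates relative to the head a move shifts the tape, so the tableau has no variables for
    head positions. [Negz n] stands for [- (n + 1)]. *)
Definition tape_get (aux : finType) (t : tape aux) (d : int) : cell aux :=
  match d with
  | Posz n => nth None (tape_head t :: tape_right t) n
  | Negz n => nth None (tape_left t) n
  end.

Definition move_offset (m : move) : int :=
  match m with MoveLeft => - 1 | Stay => 0 | MoveRight => 1 end%R.

Lemma tape_get_move (aux : finType) (m : move) (t : tape aux) (d : int) :
  tape_get (move_tape m t) d = tape_get t (d + move_offset m)%R.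
Proof.
case: m => /=; last 1 first.
- case: d => [n|[|n]].
  + by rewrite -PoszD addn1 /=; case: n => [|n] /=; [case: (tape_right t) | rewrite nth_behead].
  + by rewrite (_ : (_ + 1)%R = Posz 0).
  + by rewrite (_ : (_ + 1)%R = Negz n) //; lia.
- case: d => [[|n]|n] /=.
  + by case: (tape_left t).
  + by rewrite subn1.
  + by rewrite addn0 nth_behead.
by rewrite GRing.addr0.
Qed.

Lemma tape_get_write (aux : finType) (c : cell aux) (t : tape aux) (d : int) :
  tape_get (write_tape c t) d = if d == 0%R then c else tape_get t d.
Proof. by case: d => [[|n]|n]. Qed.

Lemma tape_get_word (aux : finType) (w : bits) (d : int) :
  tape_get (word_tape aux w) d =
  if d is Posz n then nth None (map (@bit_cell aux) w) n else None.
Proof.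
case: d => n /=; last by rewrite nth_nil.
by case: w n => [|b w] [|n] //=; rewrite nth_nil.
Qed.

(** Both conditions on the right inspect single cells, which lets clauses of the tableau state the
    output. *)
Lemma leading_bitsP (aux : finType) (s : seq (cell aux)) (y : bits) :
  leading_bits s = y <->
  (forall i, i < size y -> nth None s i = bit_cell aux (nth false y i)) /\
  (forall b, nth None s (size y) <> bit_cell aux b).
Proof.
elim: y s => [|b y IHy] [|[[c|a]|] s] /=; split=> //.
- by case=> _ /(_ c).
- by case=> /(_ 0 isT).
- case=> -> /IHy[H1 H2]; split=> [[|i] // /H1 //|//].
- case=> H1 H2; congr (_ :: _); first by case: (H1 0 isT).
  by apply/IHy; split=> [i lti|//]; apply: (H1 i.+1).
- by case=> /(_ 0 isT).
- by case=> /(_ 0 isT).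
Qed.

Lemma tape_wordP (aux : finType) (t : tape aux) (y : bits) :
  tape_word t = y <->
  (forall i : nat, i < size y -> tape_get t i = bit_cell aux (nth false y i)) /\
  (forall b, tape_get t (size y) <> bit_cell aux b).
Proof. exact: leading_bitsP. Qed.

Section Step.

Variable M : tm.
Local Notation cellM := (cell (tm_aux M)).
Local Notation tapeI := ('I_(tm_tapes M).+1).

Definition scanned (c : config M) : {ffun tapeI -> cellM} :=
  [ffun i => tape_head (conf_tape c i)].

Definition next_state (q : tm_state M) (s : {ffun tapeI -> cellM}) : tm_state M :=
  if tm_halt q then q else (tm_trans q s).1.

(** After the move, offset [d] shows what was at [d + move_offset mv]: the cell just written if this
    is 0, and otherwise one of the three old cells around [d]. *)
Definition next_cell (q : tm_state M) (s : {ffun tapeI -> cellM}) (i : tapeI)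
    (d : int) (l m r : cellM) : cellM :=
  if tm_halt q then m else
  let: (c, mv) := (tm_trans q s).2 i in
  if (d + move_offset mv == 0)%R then c else
  match mv with MoveLeft => l | Stay => m | MoveRight => r end.

Lemma tm_step_state (c : config M) :
  conf_state (tm_step c) = next_state (conf_state c) (scanned c).
Proof.
rewrite /tm_step /tm_halted /next_state /scanned.
by case: ifP => // _; case: tm_trans.
Qed.

Lemma tm_step_get (c : config M) (i : tapeI) (d : int) :
  tape_get (conf_tape (tm_step c) i) d =
  next_cell (conf_state c) (scanned c) i d
    (tape_get (conf_tape c i) (d - 1)%R) (tape_get (conf_tape c i) d)
    (tape_get (conf_tape c i) (d + 1)%R).
Proof.
rewrite /tm_step /tm_halted /next_cell /scanned.
case: ifP => // _; case: tm_trans => q act /=; case: (act i) => a mv /=.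
rewrite tape_get_move tape_get_write; case: ifP => // _.
by case: mv => //=; rewrite GRing.addr0.
Qed.

End Step.

(** * The Cook-Levin tableau *)

(* A bit of a projection: a constant, or an input bit up to negation. *)
Definition plit : Type := bool + nat * bool.

Definition plit_val (u : bits) (l : plit) : bool :=
  match l with inl b => b | inr (e, b) => nth false u e (+) b end.

Definition plit_bounded (z : nat) (l : plit) : bool :=
  if l is inr (e, _) then e < z else true.

Section Tableau.

Variables (M : tm) (z T : nat) (lits : seq plit) (y : bits).
Hypothesis litsP : all (plit_bounded z) lits.

Local Notation cellM := (cell (tm_aux M)).
Local Notation tapeI := ('I_(tm_tapes M).+1).

(* Cells are recorded at distance at most [W] of the head.  The tableau pins the
   cells at time [t] down only at distance at most [W - t], which is enough to
   read the output at time [T]. *)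
Let W := size lits + T + size y + 1.

Let var : finType :=
  ('I_T.+1 * tm_state M + 'I_T.+1 * tapeI * 'I_(2 * W).+1 * cellM)%type.

Let stv (t : nat) (q : tm_state M) : var := inl (inord t, q).
Let cellv (t : nat) (i : tapeI) (p : nat) (c : cellM) : var :=
  inr (inord t, i, inord p, c).

Let num (v : var) : nat := z + enum_rank v.

(** An implication from [hs] to [g], with [None] for falsity. No clause says that a cell has at most
    one content: the implications force the true facts of the run, and wrong outputs are forbidden,
    which is enough for soundness. *)
Let horn (hs : seq var) (g : option var) : seq lit :=
  (if g is Some v then [:: (num v, true)] else [::]) ++ [seq (num v, false) | v <- hs].

Let hyps (t : nat) (q : tm_state M) (s : {ffun tapeI -> cellM}) : seq var :=
  stv t q :: [seq cellv t j W (s j) | j <- enum tapeI].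

(** The number [e] is below [z], hence an input variable: the two clauses say that [e] false gives
    the content [c] and [e] true the content [~~ c]. *)
Let init_cell (i : tapeI) (p : nat) : cnf :=
  match nth (inl false) lits (p - W), (i == ord0) && (W <= p < W + size lits) with
  | inl b, true => [:: horn [::] (Some (cellv 0 i p (bit_cell _ b)))]
  | inr (e, c), true =>
      [:: [:: (e, true)] ++ horn [::] (Some (cellv 0 i p (bit_cell _ c)));
          [:: (e, false)] ++ horn [::] (Some (cellv 0 i p (bit_cell _ (~~ c))))]
  | _, false => [:: horn [::] (Some (cellv 0 i p None))]
  end.

Let init_part : cnf :=
  flatten [seq init_cell a.1 (nat_of_ord a.2) | a <- enum {: tapeI * 'I_(2 * W).+1}].

Let state_part : cnf :=
  [seq horn (hyps (nat_of_ord a.1) a.2.1 a.2.2)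
     (Some (stv (nat_of_ord a.1).+1 (next_state a.2.1 a.2.2)))
  | a <- enum {: 'I_T * (tm_state M * {ffun tapeI -> cellM})}].

Let cell_clause (t p : nat) (i : tapeI) q s (n : cellM * cellM * cellM) : seq lit :=
  let: (l, m, r) := n in
  horn ([:: cellv t i p.-1 l; cellv t i p m; cellv t i p.+1 r] ++ hyps t q s)
    (Some (cellv t.+1 i p (next_cell q s i (p%:Z - W%:Z)%R l m r))).

Let cell_part : cnf :=
  [seq cell_clause (nat_of_ord a.1.1) (nat_of_ord a.1.2).+1 a.2.1.1 a.2.1.2.1
         a.2.1.2.2 a.2.2
  | a <- enum {: 'I_T * 'I_(2 * W).-1 *
         (tapeI * (tm_state M * {ffun tapeI -> cellM}) * (cellM * cellM * cellM))}].

Let bad_out (d : nat) (c : cellM) : bool :=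
  if d < size y then c != bit_cell _ (nth false y d)
  else if c is Some (inl _) then true else false.

Let out_part : cnf :=
  [seq horn [:: cellv T ord_max (W + nat_of_ord a.1) a.2] None
  | a <- [seq a <- enum {: 'I_(size y).+1 * cellM} | bad_out (nat_of_ord a.1) a.2]].

Let tableau : cnf :=
  [:: horn [::] (Some (stv 0 (tm_start M)))] ++ init_part ++ state_part ++ cell_part ++ out_part.

Let run (u : bits) (t : nat) : config M :=
  iter t (@tm_step M) (tm_init M [seq plit_val u l | l <- lits]).

Let truth (u : bits) (v : var) : bool :=
  match v with
  | inl (t, q) => conf_state (run u t) == q
  | inr (t, i, p, c) => tape_get (conf_tape (run u t) i) ((p : nat)%:Z - W%:Z)%R == c
  end.

Section Assignment.

Variables (u w : bits).
Hypothesis szu : size u = z.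

Let A (v : var) : bool := nth false w (enum_rank v).

Let sat_num v b : sat_lit (u ++ w) (num v, b) = (A v == b).
Proof.
by rewrite /sat_lit /= /num nth_cat szu ltnNge leq_addr /= addKn.
Qed.

Let sat_horn hs g :
  has (sat_lit (u ++ w)) (horn hs g) = (all A hs ==> oapp A false g).
Proof.
rewrite has_cat has_map implybE orbC; congr (_ || _).
  rewrite -has_predC; apply: eq_has => v /=.
  by rewrite sat_num; case: (A v).
by case: g => //= v; rewrite orbF sat_num eqb_id.
Qed.

Let init_val (i : tapeI) (p : nat) : cellM :=
  if (i == ord0) && (W <= p < W + size lits)
  then bit_cell _ (plit_val u (nth (inl false) lits (p - W))) else None.

Let sat1 c : sat (u ++ w) [:: c] = has (sat_lit (u ++ w)) c.
Proof. exact: andbT. Qed.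

Let get_init i p : tape_get (conf_tape (run u 0) i) (p%:Z - W%:Z)%R = init_val i p.
Proof.
rewrite /run /= tape_get_word /init_val.
case: eqP => _ /=; last by case: (_ - _)%R => // n; rewrite nth_nil.
case: (leqP W p) => [le_Wp|lt_pW] /=; last first.
  by case E: (_ - _)%R => //; lia.
have -> : (p%:Z - W%:Z)%R = Posz (p - W) by lia.
case: ltnP => [lt_p|ge_p].
  have lt_p' : p - W < size lits by lia.
  by rewrite (nth_map false) ?size_map // (nth_map (inl false)).
by rewrite nth_default // !size_map; lia.
Qed.

Let sat_init_cell i p :
  sat (u ++ w) (init_cell i p) = A (cellv 0 i p (init_val i p)).
Proof.
rewrite /init_cell /init_val.
case E: (_ && _); last first.
  by case: nth => [b|[e c]]; rewrite sat1 sat_horn /=.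
have ltp : p - W < size lits by move/and3P: E => [_ ? ?]; lia.
case En: nth => [b|[e c]]; first by rewrite sat1 sat_horn /=.
have lt_ez : e < z.
  by move/allP/(_ _ (mem_nth (inl false) ltp)): litsP; rewrite En.
rewrite -[[:: _; _]]cat1s sat_cat !sat1 2!(has_cat (sat_lit (u ++ w)) [:: _]) !sat_horn /= !orbF.
have sat_e b : sat_lit (u ++ w) (e, b) = (nth false u e == b).
  by rewrite /sat_lit /= nth_cat szu lt_ez.
by rewrite !sat_e ?sat_num; case: (nth false u e); rewrite /= ?eqb_id ?andbT.
Qed.


Let sat_map (X : Type) (F : X -> seq lit) (s : seq X) :
  sat (u ++ w) [seq F a | a <- s] = all (fun a => has (sat_lit (u ++ w)) (F a)) s.
Proof. exact: all_map. Qed.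

Let tableau_tests :=
  [/\ A (stv 0 (tm_start M)),
      forall i p, p <= 2 * W -> A (cellv 0 i p (init_val i p)),
      forall t q s, t < T -> all A (hyps t q s) -> A (stv t.+1 (next_state q s)),
      forall t p i q s l m r, t < T -> 0 < p < 2 * W ->
        [&& A (cellv t i p.-1 l), A (cellv t i p m), A (cellv t i p.+1 r)
          & all A (hyps t q s)] ->
        A (cellv t.+1 i p (next_cell q s i (p%:Z - W%:Z)%R l m r))
    & forall d c, d <= size y -> bad_out d c -> ~~ A (cellv T ord_max (W + d) c)].

Let sat_tableau : sat (u ++ w) tableau <-> tableau_tests.
Proof.
rewrite !sat_cat sat1 sat_horn /= !sat_map.
split=> [/and5P[H1 /allP H2 /allP H3 /allP H4 /allP H5]|[H1 H2 H3 H4 H5]].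
  split=> //.
  - move=> i p lep; rewrite -sat_init_cell; apply/allP => c cin; apply: H2.
    have ltp : p < (2 * W).+1 by [].
    apply/flattenP; exists (init_cell i p) => //.
    by apply/mapP; exists (i, Ordinal ltp); rewrite ?mem_enum.
  - move=> t q s ltT hs.
    have := H3 (Ordinal ltT, (q, s)); rewrite mem_enum => /(_ isT).
    by rewrite sat_horn hs.
  - move=> t p i q s l m r ltT /andP[p0 pW] hs.
    have ltp : p.-1 < (2 * W).-1 by lia.
    have := H4 (Ordinal ltT, Ordinal ltp, (i, (q, s), (l, m, r))).
    rewrite mem_enum => /(_ isT); rewrite prednK // sat_horn all_cat /= andbT.
    by move: hs; rewrite -!andbA /= => ->.
  - move=> d c led bad; have ltd : d < (size y).+1 by [].
    have := H5 (Ordinal ltd, c); rewrite mem_filter mem_enum bad => /(_ isT).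
    by rewrite sat_horn /= andbT implybF.
apply/and5P; split=> //; apply/allP.
- move=> c /flattenP[_ /mapP[[i p] _ ->]] cin.
  have: sat (u ++ w) (init_cell i p) by rewrite sat_init_cell H2 // -ltnS.
  by move/allP/(_ c cin).
- by move=> [t [q s]] _; rewrite sat_horn; apply/implyP; apply: H3.
- move=> [[t p] [[i [q s]] [[l m] r]]] _; rewrite sat_horn; apply/implyP.
  rewrite all_cat /= andbT -!andbA => hs; apply: H4 => //.
  by have := ltn_ord p; lia.
- move=> [d c]; rewrite mem_filter => /andP[bad _]; rewrite sat_horn /= andbT implybF.
  by apply: H5 => //; rewrite -ltnS.
Qed.

Let get_head t j :
  tape_get (conf_tape (run u t) j) (W%:Z - W%:Z)%R = scanned (run u t) j.
Proof. by rewrite ffunE GRing.subrr. Qed.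

Lemma tableau_sound : sat (u ++ w) tableau -> tm_output (run u T) = y.
Proof.
move/sat_tableau => [H1 H2 H3 H4 H5].
(* Forward propagation loses one cell on either side per step, since the outermost cells have no
   neighbour to be derived from. *)
have inv t : t <= T -> A (stv t (conf_state (run u t))) /\
    forall i p, t <= p -> p + t <= 2 * W ->
      A (cellv t i p (tape_get (conf_tape (run u t) i) (p%:Z - W%:Z)%R)).
  elim: t => [_|t IHt ltT].
    by split=> // i p _; rewrite addn0 get_init; apply: H2.
  case: (IHt (ltnW ltT)) => IH1 IH2.
  have hs : all A (hyps t (conf_state (run u t)) (scanned (run u t))).
    rewrite /= IH1 all_map; apply/allP => j _ /=; rewrite -get_head.
    by apply: IH2; rewrite /W; lia.
  rewrite /run iterS -/(run u t); split.
    by rewrite tm_step_state; apply: H3.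
  move=> i p lep leW; rewrite tm_step_get.
  apply: H4; [by []|by lia|]; rewrite hs andbT.
  rewrite (_ : (_ - _ - 1)%R = (p.-1%:Z - W%:Z)%R); last by lia.
  rewrite (_ : (_ - _ + 1)%R = (p.+1%:Z - W%:Z)%R); last by lia.
  by apply/and3P; split; apply: IH2; lia.
have [_ AT] := inv T (leqnn T).
have outT d : d <= size y ->
    A (cellv T ord_max (W + d) (tape_get (conf_tape (run u T) ord_max) d)).
  move=> led; have -> : (d : int) = ((W + d)%N%:Z - W%:Z)%R by lia.
  by apply: AT; rewrite /W; lia.
apply/tape_wordP; split=> [i lti|b Eb].
  apply/eqP; apply: contraTT (outT i (ltnW lti)) => neq.
  by apply: H5 (ltnW lti) _; rewrite /bad_out lti.
have := outT (size y) (leqnn _); rewrite Eb; apply/negP.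
by apply: H5; rewrite // /bad_out ltnn.
Qed.

Lemma tableau_complete : (forall v, A v = truth u v) -> tm_output (run u T) = y ->
  sat (u ++ w) tableau.
Proof.
move=> Atruth /tape_wordP[out1 out2].
have Ast t q : t <= T -> A (stv t q) = (conf_state (run u t) == q).
  by move=> leT; rewrite Atruth /= inordK.
have Acell t i p c : t <= T -> p <= 2 * W ->
    A (cellv t i p c) = (tape_get (conf_tape (run u t) i) (p%:Z - W%:Z)%R == c).
  by move=> leT leW; rewrite Atruth /= !inordK.
have Ahyps t q s : t <= T -> all A (hyps t q s) ->
    q = conf_state (run u t) /\ s = scanned (run u t).
  move=> leT; rewrite /= Ast // => /andP[/eqP-> hs]; split=> //.
  apply/ffunP => j; move: hs; rewrite all_map => /allP/(_ j); rewrite mem_enum.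
  move=> /(_ isT) /=; rewrite Acell ?get_head // => [/eqP//|]; lia.
apply/sat_tableau; split.
- by rewrite Ast.
- by move=> i p lep; rewrite Acell // get_init.
- move=> t q s ltT /(Ahyps _ _ _ (ltnW ltT))[-> ->].
  by rewrite Ast // /run iterS -tm_step_state.
- move=> t p i q s l m r ltT /andP[p0 pW] /and4P[hl hm hr].
  case/(Ahyps _ _ _ (ltnW ltT)) => -> ->; move: hl hm hr.
  rewrite !Acell //; try lia.
  rewrite (_ : (p.-1%:Z - _)%R = (p%:Z - W%:Z - 1)%R); last by lia.
  rewrite (_ : (p.+1%:Z - _)%R = (p%:Z - W%:Z + 1)%R); last by lia.
  by move=> /eqP<- /eqP<- /eqP<-; rewrite /run iterS -/(run u t) tm_step_get.
move=> d c led; rewrite /bad_out Acell //; last by rewrite /W; lia.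
have -> : ((W + d)%N%:Z - W%:Z)%R = d by lia.
case: ltnP => [ltd|ged]; first by rewrite out1 // eq_sym.
have -> : d = size y by apply/eqP; rewrite eqn_leq led.
by case: c => [[b|a]|] // _; apply/eqP/out2.
Qed.

End Assignment.

Let num_lt v : num v < z + #|var|.
Proof. by rewrite ltn_add2l ltn_ord. Qed.

Let horn_bounded hs g : all (fun l : lit => l.1 < z + #|var|) (horn hs g).
Proof.
rewrite all_cat all_map; apply/andP; split.
  by case: g => //= v; rewrite num_lt.
by apply/allP => v _; apply: num_lt.
Qed.

Let tableau_bounded : cnf_bounded (z + #|var|) tableau.
Proof.
have bounded_map (X : Type) (F : X -> seq lit) (s : seq X) :
    (forall a, all (fun l : lit => l.1 < z + #|var|) (F a)) ->
    cnf_bounded (z + #|var|) [seq F a | a <- s].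
  by move=> Fb; rewrite /cnf_bounded all_map; elim: s => //= a s ->; rewrite Fb.
have cat_bounded f g : cnf_bounded (z + #|var|) f -> cnf_bounded (z + #|var|) g ->
    cnf_bounded (z + #|var|) (f ++ g).
  by rewrite /cnf_bounded all_cat => -> ->.
apply: (cat_bounded); first by rewrite /cnf_bounded /= num_lt.
apply: (cat_bounded); last first.
  apply: (cat_bounded); first by apply: bounded_map => a; apply: horn_bounded.
  apply: (cat_bounded); last by apply: bounded_map => a; apply: horn_bounded.
  apply: bounded_map => -[[t p] [[i [q s]] [[l m] r]]]; exact: horn_bounded.
apply/allP => c /flattenP[_ /mapP[[i p] _ ->]]; rewrite /init_cell /=.
case E: (_ && _); last first.
  by case: nth => [b|[e b]]; rewrite inE => /eqP->; apply: horn_bounded.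
have ltp : p - W < size lits by move/and3P: E => [_ ? ?]; lia.
case En: nth => [b|[e b]]; first by rewrite inE => /eqP->; apply: horn_bounded.
have lt_ez : e < z.
  by move/allP/(_ _ (mem_nth (inl false) ltp)): litsP; rewrite En.
by rewrite !inE => /orP[]/eqP->; rewrite /= ltn_addr //= num_lt.
Qed.

Let size_horn hs g : size (horn hs g) <= size hs + 1.
Proof. by rewrite size_cat size_map; case: g => [v|] /=; lia. Qed.

Let cnf_size_map (X : Type) (F : X -> seq lit) (s : seq X) (b : nat) :
  (forall a, size (F a) < b) -> cnf_size [seq F a | a <- s] <= size s * b.
Proof.
move=> Fb; elim: s => //= a s IHs.
by rewrite mulSn; apply: leq_add; first exact: Fb.
Qed.

(** The summands bound, in units of [W ^ 2], the variables (the first two), the start clause, the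
    initial cells, the state clauses, the cell clauses and the output clauses. The value depends on
    the machine only. *)
Definition tableau_const : nat :=
  let Q := #|tm_state M| in let C := #|{: cellM}| in let k := (tm_tapes M).+1 in
  let F := #|{ffun tapeI -> cellM}| in
  Q + 3 * k * C + 2 + 18 * k + Q * F * (k + 3) + 2 * k * (Q * F) * (C * C * C) * (k + 6)
  + 3 * C.

Let tableau_size : #|var| + cnf_size tableau <= tableau_const * W ^ 2.
Proof.
rewrite !cnf_size_cat.
set Q := #|tm_state M|; set C := #|{: cellM}|; set k := (tm_tapes M).+1.
set F := #|{ffun tapeI -> cellM}|.
have W0 : 0 < W by rewrite /W addn1.
have WW : W <= W ^ 2 by rewrite -mulnn leq_pmulr.
have TW : T.+1 <= W by rewrite /W; lia.
have yW : (size y).+1 <= W by rewrite /W; lia.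
have W3 : (2 * W).+1 <= 3 * W by lia.
have sz_hyps t q s : size (hyps t q s) = k.+1.
  by rewrite /= size_map -cardE card_ord.
have Hvar : #|var| <= (Q + 3 * k * C) * W ^ 2.
  rewrite card_sum !card_prod !card_ord -/Q -/C -/k mulnDl leq_add //.
    by rewrite mulnC leq_mul // (leq_trans TW).
  apply: (@leq_trans (W * k * (3 * W) * C)); last by rewrite -mulnn; lia.
  by rewrite !leq_mul.
have Hinit : cnf_size init_part <= 18 * k * W ^ 2.
  have: cnf_size init_part <= size (enum {: tapeI * 'I_(2 * W).+1}) * 6.
    apply: cnf_size_flatten => -[i p] /=; rewrite /init_cell.
    by case: (_ && _); case: nth => [b|[e b]].
  rewrite -cardE card_prod !card_ord -/k => /leq_trans; apply.
  nia.
have Hst : cnf_size state_part <= Q * F * (k + 3) * W ^ 2.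
  have: cnf_size state_part <=
      size (enum {: 'I_T * (tm_state M * {ffun tapeI -> cellM})}) * (k + 3).
    apply: cnf_size_map => -[t [q s]].
    by apply: leq_ltn_trans (size_horn _ _) _; rewrite sz_hyps; lia.
  rewrite -cardE !card_prod !card_ord -/Q -/F => /leq_trans; apply.
  have: T * (Q * F * (k + 3)) <= W ^ 2 * (Q * F * (k + 3)) by rewrite leq_mul //; lia.
  lia.
have Hcell : cnf_size cell_part <= 2 * k * (Q * F) * (C * C * C) * (k + 6) * W ^ 2.
  have: cnf_size cell_part <= size (enum {: 'I_T * 'I_(2 * W).-1 *
         (tapeI * (tm_state M * {ffun tapeI -> cellM}) * (cellM * cellM * cellM))})
         * (k + 6).
    apply: cnf_size_map => -[[t p] [[i [q s]] [[l m] r]]].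
    by apply: leq_ltn_trans (size_horn _ _) _; rewrite /= size_map -cardE card_ord -/k; lia.
  rewrite -cardE !card_prod !card_ord -/Q -/F -/C => /leq_trans; apply.
  rewrite -/k.
  have: T * (2 * W).-1 <= 2 * W ^ 2.
    by rewrite -mulnn mulnCA leq_mul //; lia.
  move=> H; rewrite !mulnA.
  have := leq_mul H (leqnn (k * Q * F * C * C * C * (k + 6))).
  lia.
have Hout : cnf_size out_part <= 3 * C * W ^ 2.
  have: cnf_size out_part <=
      size [seq a <- enum {: 'I_(size y).+1 * cellM} | bad_out (nat_of_ord a.1) a.2] * 3.
    by apply: cnf_size_map => a.
  move/leq_trans; apply.
  have: size [seq a <- enum {: 'I_(size y).+1 * cellM} | bad_out (nat_of_ord a.1) a.2]
     <= (size y).+1 * C.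
    rewrite size_filter (leq_trans (count_size _ _)) // -cardE card_prod card_ord //.
  have: (size y).+1 * C <= W ^ 2 * C by rewrite leq_mul // (leq_trans yW).
  lia.
have H0 : cnf_size [:: horn [::] (Some (stv 0 (tm_start M)))] <= 2 * W ^ 2.
  by rewrite /cnf_size /=; lia.
have -> : tableau_const = Q + 3 * k * C + 2 + 18 * k + Q * F * (k + 3) +
    2 * k * (Q * F) * (C * C * C) * (k + 6) + 3 * C by [].
by clearbody Q C k F; clear -Hvar Hinit Hst Hcell Hout H0; lia.
Qed.

Lemma cnf_def_tableau :
  cnf_def z (tableau_const * W ^ 2) (fun u => tm_output
    (iter T (@tm_step M) (tm_init M [seq plit_val u l | l <- lits])) = y).
Proof.
exists #|var|, tableau; split=> // u szu; split=> [outP|[w _ satw]]; last first.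
  exact: tableau_sound szu satw.
exists [seq truth u v | v <- enum var]; first by rewrite size_map -cardE.
apply: tableau_complete => // v.
by rewrite (nth_map v) ?nth_enum_rank // -cardE ltn_ord.
Qed.

End Tableau.

(** * A machine that evaluates CNFs given as advice *)

(* Programs are words read by a machine whose head moves on the assignment tape.
   An instruction has three bits: [1 b _] sets the flag if the scanned bit is
   [b], [0 0 d] moves the head (right iff [d]), [0 1 0] ends a clause and [0 1 1]
   starts the comparison of the assignment with the rest of the program.
   In [prog_mode], [inl] holds the bits of the current instruction that have
   been read; in the comparison, [None] skips the separator of [enc_pair],
   [Some false] compares a bit and [Some true] skips a marker of [enc_pair]. *)
Definition prog_mode : finType := (option (bool * option bool) + option bool)%type.
Definition prog_state : finType := (prog_mode * bool * bool)%type.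

Definition prog_step (s : prog_state) (b : bool) (c : cell void) : prog_state * move :=
  let: (m, flag, ok) := s in
  match m with
  | inl None => (inl (Some (b, None)), flag, ok, Stay)
  | inl (Some (b1, None)) => (inl (Some (b1, Some b)), flag, ok, Stay)
  | inl (Some (true, Some b2)) => (inl None, flag || (c == bit_cell _ b2), ok, Stay)
  | inl (Some (false, Some false)) =>
      (inl None, flag, ok, if b then MoveRight else MoveLeft)
  | inl (Some (false, Some true)) =>
      if b then (inr None, false, ok, Stay) else (inl None, false, ok && flag, Stay)
  | inr None => (inr (Some false), flag, ok, Stay)
  | inr (Some false) => (inr (Some true), flag, ok && (c == bit_cell _ b), MoveLeft)
  | inr (Some true) => (inr (Some false), flag, ok, Stay)
  end.

Definition prog_run (st : prog_state * tape void) (prog : bits) : prog_state * tape void :=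
  foldl (fun st b => let: (s, m) := prog_step st.1 b (tape_head st.2) in
                     (s, move_tape m st.2)) st prog.

Definition prog_start : prog_state := (inl None, false, true).

(* [Some (inl b)] copies the first component of the input to the last tape, [b]
   telling whether a marker has just been read; [Some (inr s)] executes this copy
   as a program, from right to left, on the second component of the input. *)
Definition eval_state : finType := option (bool + prog_state).

Definition eval_trans (s : eval_state) (c0 c1 : cell void) :
    eval_state * (cell void * move) * (cell void * move) :=
  match s with
  | Some (inl false) =>
      match c0 with
      | Some (inl true) => (Some (inl true), (c0, MoveRight), (c1, Stay))
      | Some (inl false) => (Some (inr prog_start), (c0, MoveRight), (c1, MoveLeft))
      | _ => (None, (c0, Stay), (c1, Stay))
      end
  | Some (inl true) => (Some (inl false), (c0, MoveRight), (c0, MoveRight))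
  | Some (inr p) =>
      match c1 with
      | Some (inl b) =>
          let: (p', m) := prog_step p b c0 in
          (Some (inr p'), (c0, m), (None, MoveLeft))
      | _ => (None, (c0, Stay), (bit_cell _ p.2, Stay))
      end
  | None => (None, (c0, Stay), (c1, Stay))
  end.

Arguments eval_trans : simpl never.

Definition eval_tm : tm := @TM void eval_state 1 (Some (inl false)) (pred1 None)
  (fun s v => let: (q, a0, a1) := eval_trans s (v ord0) (v ord_max) in
              (q, fun i => if i == ord0 then a0 else a1)).

(** The tapes are compared one by one, so no equality of functions of the tape index is asserted. *)
Definition conf_is (c : config eval_tm) (s : eval_state) (t0 t1 : tape void) : Prop :=
  [/\ conf_state c = s, conf_tape c ord0 = t0 & conf_tape c ord_max = t1].

Lemma eval_step (c : config eval_tm) (s : bool + prog_state) (t0 t1 : tape void) :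
  conf_is c (Some s) t0 t1 ->
  let: (q, a0, a1) := eval_trans (Some s) (tape_head t0) (tape_head t1) in
  conf_is (tm_step c) q (move_tape a0.2 (write_tape a0.1 t0))
    (move_tape a1.2 (write_tape a1.1 t1)).
Proof.
case: c => q tp [Eq E0 E1]; set e := eval_trans _ _ _.
rewrite /= in Eq E0 E1; rewrite Eq; have ->: tm_step (Config (Some s : tm_state eval_tm) tp) =
    Config (M := eval_tm) e.1.1
      (fun i => let a := if i == ord0 then e.1.2 else e.2 in
                move_tape a.2 (write_tape a.1 (tp i))).
  by rewrite /tm_step /tm_halted [LHS]/= !ffunE E0 E1 -/e; case: e => [[q' a0] a1].
by case: e => [[q' a0] a1]; split; rewrite /= ?E0 ?E1.
Qed.

Definition input_tape (l r : seq (cell void)) : tape void :=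
  Tape l (head None r) (behead r).

Lemma tape_get_input (l r : seq (cell void)) (e : nat) :
  tape_get (input_tape l r) e = nth None r e.
Proof. by case: r e => [|c r] [|e] //=; rewrite nth_nil. Qed.

(** The list [l] runs from the head leftwards. Executed cells are erased, so the bit written at the
    end is followed by a blank and is the whole output. *)
Definition program_tape (l : seq (cell void)) (k : nat) : tape void :=
  Tape (behead l) (head None l) (nseq k None).

Lemma eval_copy (u w : bits) (l l1 : seq (cell void)) (c : config eval_tm) :
  conf_is c (Some (inl false))
    (input_tape l (map (@bit_cell void) (enc_pair (u, w)))) (Tape l1 None [::]) ->
  exists l', conf_is (iter (2 * size u).+1 (@tm_step eval_tm) c)
    (Some (inr prog_start)) (input_tape l' (map (@bit_cell void) w))
    (program_tape (rev (map (@bit_cell void) u) ++ l1) 1).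
Proof.
elim: u l l1 c => [|b u IHu] l l1 c Hc.
  by have := eval_step Hc; rewrite /eval_trans; exists (bit_cell _ false :: l).
have := eval_step Hc; rewrite /eval_trans => /eval_step; rewrite /eval_trans => Hc2.
have [l' Hl'] := IHu _ _ _ Hc2; exists l'.
rewrite map_cons rev_cons cat_rcons (_ : (2 * size (b :: u)).+1 = (2 * size u).+3).
  by rewrite 2!iterSr; apply: Hl'.
by rewrite /=; lia.
Qed.

Lemma eval_program (l : bits) (k : nat) (s : prog_state) (t : tape void)
    (c : config eval_tm) :
  conf_is c (Some (inr s)) t (program_tape (map (@bit_cell void) l) k) ->
  exists t1, conf_is (iter (size l).+1 (@tm_step eval_tm) c) None
    (prog_run (s, t) l).2 t1 /\ tape_word t1 = [:: (prog_run (s, t) l).1.2].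
Proof.
have writeK (t' : tape void) : write_tape (tape_head t') t' = t' by case: t'.
elim: l k s t c => [|b l IHl] k s t c Hc.
  have := eval_step Hc; rewrite /eval_trans /= writeK => Hc'.
  exists (write_tape (bit_cell _ s.2) (program_tape [::] k)); split=> //.
  by rewrite /tape_word /=; case: k {Hc Hc'}.
have := eval_step Hc; rewrite /eval_trans /=; case: prog_step => s' m /=; rewrite writeK => Hc'.
by rewrite -iterS iterSr; apply: (IHl k.+1 s' _ _ Hc').
Qed.



Lemma iter_halted (M : tm) (c : config M) (k : nat) :
  tm_halted c -> iter k (@tm_step M) c = c.
Proof. by move=> Hc; elim: k => //= k ->; rewrite /tm_step Hc. Qed.

Lemma size_enc_pair (u w : bits) : size (enc_pair (u, w)) = 2 * size u + 1 + size w.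
Proof.
rewrite /enc_pair size_cat /= -addn1 addnA addnAC; congr (_ + _ + _).
by elim: u => //= b u ->; lia.
Qed.

Lemma eval_output (u w : bits) : exists l',
  let c := iter (2 * size (enc_pair (u, w))) (@tm_step eval_tm)
             (tm_init eval_tm (enc_pair (u, w))) in
  tm_halted c /\ tm_output c =
    [:: (prog_run (prog_start, input_tape l' (map (@bit_cell void) w)) (rev u)).1.2].
Proof.
have [|l' Hl'] := @eval_copy u w [::] [::] (tm_init eval_tm (enc_pair (u, w))).
  by split.
rewrite cats0 -map_rev in Hl'; exists l'.
have [t1 [[Hs _ Ht] out]] := eval_program Hl'.
rewrite -iterD size_rev in Hs Ht.
(* The copy and the execution take [3 * size u + 2] steps; the machine has halted during the
   others. *)
have -> : 2 * size (enc_pair (u, w)) =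
    (size u + 2 * size w) + ((size u).+1 + (2 * size u).+1).
  by rewrite size_enc_pair; lia.
rewrite iterD iter_halted; first last.
  by rewrite /tm_halted Hs.
by split; [rewrite /tm_halted Hs | rewrite /tm_output Ht].
Qed.

(** Defined by the run itself, so that its polynomial time requires no description of the answer on
    words that encode no program. *)
Definition eval_accepts (uw : bits * bits) : bool :=
  tm_output (iter (2 * size (enc_pair uw)) (@tm_step eval_tm)
               (tm_init eval_tm (enc_pair uw))) == [:: true].

Lemma poly_time_eval : poly_time enc_pair enc_bool eval_accepts.
Proof.
exists eval_tm, ('X *+ 2)%R => -[u w] /=.
rewrite hornerMn hornerX (_ : (_ *+ 2)%R = 2 * size (enc_pair (u, w))); last first.
  by rewrite mul2n -addnn.
have [l' [Hh out]] := eval_output u w; split; first exact: Hh.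
by rewrite /eval_accepts out; case: (_.2).
Qed.

Definition move_right : bits := [:: false; false; true].
Definition move_left : bits := [:: false; false; false].
Definition test_bit (b : bool) : bits := [:: true; b; true].
Definition end_clause : bits := [:: false; true; false].
Definition start_comparison : bits := [:: false; true; true].

Definition repeat_prog (e : nat) (prog : bits) : bits := flatten (nseq e prog).

Definition lit_prog (l : lit) : bits :=
  repeat_prog l.1 move_right ++ test_bit l.2 ++ repeat_prog l.1 move_left.

Definition clause_prog (c : seq lit) : bits :=
  flatten [seq lit_prog l | l <- c] ++ end_clause.

(* The [r] useless tests only make the program longer than the assignments. *)
Definition cnf_prog (n r : nat) (f : cnf) : bits :=
  flatten [seq clause_prog c | c <- f] ++ repeat_prog r (test_bit true) ++
  repeat_prog n.-1 move_right ++ start_comparison.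

Section ProgramSemantics.

Variable t0 : tape void.

Let lit_true (l : lit) : bool := tape_get t0 l.1 == bit_cell _ l.2.

(** Only contents are compared, because moving to and fro may append explicit blanks to the lists of
    a tape. *)
Definition shifted (t : tape void) (p : int) : Prop :=
  forall d, tape_get t d = tape_get t0 (d + p)%R.

Let shifted_move m t p : shifted t p -> shifted (move_tape m t) (p + move_offset m)%R.
Proof. by move=> Ht d; rewrite tape_get_move Ht; congr tape_get; lia. Qed.

Let shifted_head t p : shifted t p -> tape_head t = tape_get t0 p.
Proof. by move=> /(_ 0%R); rewrite GRing.add0r. Qed.

Let run_cat st p1 p2 : prog_run st (p1 ++ p2) = prog_run (prog_run st p1) p2.
Proof. exact: foldl_cat. Qed.

Let run_right e flag ok t p : shifted t p -> exists2 t',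
  prog_run ((inl None, flag, ok), t) (repeat_prog e move_right) = ((inl None, flag, ok), t')
  & shifted t' (p + e%:Z)%R.
Proof.
elim: e t p => [|e IHe] t p Ht; first by exists t; rewrite ?GRing.addr0.
have [t' Et' Ht'] := IHe _ _ (shifted_move MoveRight Ht).
by exists t'; last by rewrite (_ : (p + e.+1%:Z)%R = (p + 1 + e%:Z)%R) //; lia.
Qed.

Let run_left e flag ok t p : shifted t p -> exists2 t',
  prog_run ((inl None, flag, ok), t) (repeat_prog e move_left) = ((inl None, flag, ok), t')
  & shifted t' (p - e%:Z)%R.
Proof.
elim: e t p => [|e IHe] t p Ht; first by exists t; rewrite ?GRing.subr0.
have [t' Et' Ht'] := IHe _ _ (shifted_move MoveLeft Ht).
by exists t'; last by rewrite (_ : (p - e.+1%:Z)%R = (p - 1 - e%:Z)%R) //; lia.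
Qed.

Let run_lit l flag ok t : shifted t 0 -> exists2 t',
  prog_run ((inl None, flag, ok), t) (lit_prog l) =
    ((inl None, flag || lit_true l, ok), t')
  & shifted t' 0.
Proof.
case: l => e b Ht; rewrite /lit_prog !run_cat.
have [t1 -> Ht1] := run_right e flag ok Ht.
rewrite [prog_run (_, t1) _]/= (shifted_head Ht1).
have [t2 -> Ht2] := run_left e (flag || lit_true (e, b)) ok Ht1.
by exists t2; last by rewrite GRing.add0r GRing.subrr in Ht2.
Qed.

Let run_clause c ok t : shifted t 0 -> exists2 t',
  prog_run ((inl None, false, ok), t) (clause_prog c) =
    ((inl None, false, ok && has lit_true c), t')
  & shifted t' 0.
Proof.
rewrite /clause_prog run_cat => Ht.
have [t1 -> Ht1] : exists2 t', prog_run ((inl None, false, ok), t)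
    (flatten [seq lit_prog l | l <- c]) = ((inl None, has lit_true c, ok), t')
    & shifted t' 0; last by exists t1.
rewrite -[has _ _]orFb; elim: c false t Ht => [|l c IHc] flag t Ht.
  by exists t; rewrite ?orbF.
rewrite [flatten _]/= run_cat; have [t1 -> Ht1] := run_lit l flag ok Ht.
by have [t2 -> Ht2] := IHc (flag || lit_true l) t1 Ht1; exists t2; rewrite //= orbA.
Qed.

Let run_cnf n r f t : shifted t 0 -> exists flag t',
  prog_run (prog_start, t) (cnf_prog n r f) =
    ((inr None, flag, all (has lit_true) f), t')
  /\ shifted t' n.-1.
Proof.
rewrite /cnf_prog !run_cat => Ht.
have [t1 -> Ht1] : exists2 t', prog_run (prog_start, t)
    (flatten [seq clause_prog c | c <- f]) =
    ((inl None, false, all (has lit_true) f), t') & shifted t' 0.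
  rewrite -[all _ _]andTb /prog_start; elim: f true t Ht => [|c f IHf] ok t Ht.
    by exists t; rewrite ?andbT.
  rewrite [flatten _]/= run_cat; have [t1 -> Ht1] := run_clause c ok Ht.
  by have [t2 -> Ht2] := IHf (ok && has lit_true c) t1 Ht1; exists t2; rewrite //= andbA.
have [flag ->] : exists flag, prog_run (inl None, false, all (has lit_true) f, t1)
    (repeat_prog r (test_bit true)) = (inl None, flag, all (has lit_true) f, t1).
  by elim: r false => [|r IHr] flag; [exists flag | apply: IHr].
have [t2 -> Ht2] := run_right n.-1 flag (all (has lit_true) f) Ht1.
by exists false, t2; split; last by rewrite GRing.add0r in Ht2.
Qed.

Let run_comparison x flag ok t : shifted t ((size x)%:Z - 1)%R ->
  (prog_run ((inr (Some false), flag, ok), t)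
     (rev (flatten [seq [:: true; b] | b <- x]))).1.2 =
  ok && all (fun i => lit_true (i, nth false x i)) (iota 0 (size x)).
Proof.
elim/last_ind: x t ok => [|x b IHx] t ok Ht; first by rewrite /= andbT.
rewrite map_rcons flatten_rcons rev_cat run_cat [prog_run (_, t) _]/=.
rewrite size_rcons in Ht *; rewrite (_ : ((size x).+1%:Z - 1)%R = Posz (size x)) in Ht; last by lia.
have := shifted_move MoveLeft Ht; rewrite -[move_offset _]/(- 1)%R => Ht'.
rewrite IHx; last exact: Ht'.
rewrite (shifted_head Ht).
rewrite -[(size x).+1]addn1 iotaD all_cat /= andbT nth_rcons ltnn eqxx.
rewrite -andbA [X in _ = _ && X]andbC; congr [&& _, _ & _].
apply: eq_in_all => i; rewrite mem_iota => /andP[_ lti].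
by rewrite nth_rcons lti.
Qed.

(** Read from right to left, the word yields the program, which leaves the head at [(size x).-1],
    then the separator, then [x] backwards. The assignment tape holds a guess even for the input
    bits; the comparison verifies them. *)
Lemma prog_run_accepts (x : bits) (r : nat) (f : cnf) :
  (prog_run (prog_start, t0) (rev (enc_pair (x, rev (cnf_prog (size x) r f))))).1.2 =
  all (has lit_true) f && all (fun i => lit_true (i, nth false x i)) (iota 0 (size x)).
Proof.
have Ht0 : shifted t0 0 by move=> d; rewrite GRing.addr0.
rewrite /enc_pair rev_cat rev_cons revK cat_rcons run_cat.
have [flag [t1 [-> Ht1]]] := run_cnf (size x) r f Ht0.
case: x Ht1 => [|b x] Ht1; first by rewrite /= andbT.
rewrite -cat1s run_cat [prog_run _ [:: false]]/= run_comparison //.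
by rewrite (_ : ((size (b :: x))%:Z - 1)%R = Posz (size x)) //=; lia.
Qed.

End ProgramSemantics.

Lemma size_repeat_prog (e : nat) (prog : bits) : size (repeat_prog e prog) = e * size prog.
Proof. by elim: e => //= e IHe; rewrite size_cat IHe mulSn. Qed.

(** A literal takes at most [v] moves in each direction and one test, at three bits per
    instruction. *)
Lemma size_cnf_prog (n r v : nat) (f : cnf) : cnf_bounded v f ->
  size (cnf_prog n r f) <= (6 * v + 3) * cnf_size f + 3 * r + 3 * n + 3.
Proof.
move=> fb; rewrite /cnf_prog !size_cat !size_repeat_prog /=.
suff: size (flatten [seq clause_prog c | c <- f]) <= (6 * v + 3) * cnf_size f by lia.
elim: f fb => //= c f IHf /andP[cb /IHf{}IHf].
rewrite {1}/clause_prog !size_cat /= /cnf_size /= -/(cnf_size f).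
suff: size (flatten [seq lit_prog l | l <- c]) <= (6 * v + 3) * size c by nia.
elim: c cb => //= l c IHc /andP[lb /IHc{}IHc].
by rewrite {1}/lit_prog !size_cat !size_repeat_prog /=; nia.
Qed.

Lemma eval_accepts_cnf (x w : bits) (r : nat) (f : cnf) :
  cnf_bounded (size x + r) f ->
  eval_accepts (enc_pair (x, rev (cnf_prog (size x) r f)), w) ->
  exists2 w', size w' = r & sat (x ++ w') f.
Proof.
move=> fb; set u := enc_pair _; have [l' [_ out]] := eval_output u w.
rewrite /eval_accepts out eqseq_cons andbT eqb_id prog_run_accepts.
(* Only this implication holds, as the guess [w] may be too short: a blank satisfies no literal. *)
have bitP e b : tape_get (input_tape l' (map (@bit_cell void) w)) (Posz e) == bit_cell _ b ->
    nth false w e = b.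
  rewrite tape_get_input.
  case: (ltnP e (size w)) => [lte|gee]; last by rewrite nth_default // size_map.
  by rewrite (nth_map false) // => /eqP[].
move=> /andP[/allP fw /allP xw].
exists (mkseq (fun i => nth false w (size x + i)) r); first by rewrite size_mkseq.
apply/allP => c cf; have /hasP[l lc lw] := fw c cf; apply/hasP; exists l => //.
rewrite /sat_lit nth_cat -(bitP _ _ lw); case: ltnP => [ltx|gex].
  by apply/eqP; symmetry; apply: (bitP _ _ (xw l.1 _)); rewrite mem_iota.
rewrite nth_mkseq ?subnKC //; have /allP/(_ c cf)/allP/(_ l lc) := fb; lia.
Qed.

Lemma cnf_eval_accepts (x w : bits) (f : cnf) :
  cnf_bounded (size x + size w) f -> sat (x ++ w) f ->
  eval_accepts (enc_pair (x, rev (cnf_prog (size x) (size w) f)), x ++ w).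
Proof.
move=> fb satf; set u := enc_pair _; have [l' [_ out]] := eval_output u (x ++ w).
rewrite /eval_accepts out eqseq_cons andbT eqb_id prog_run_accepts.
have bitP e b : e < size x + size w ->
    (tape_get (input_tape l' (map (@bit_cell void) (x ++ w))) (Posz e) == bit_cell _ b) =
    (nth false (x ++ w) e == b).
  by move=> lte; rewrite tape_get_input (nth_map false) // size_cat.
apply/andP; split.
  apply/allP => c cf; have /allP/(_ c cf)/hasP[l lc lw] := satf.
  apply/hasP; exists l => //; rewrite bitP //.
  by have /allP/(_ c cf)/allP/(_ l lc) := fb.
apply/allP => i; rewrite mem_iota => /andP[_ lti].
by rewrite bitP ?nth_cat ?lti // ltn_addr.
Qed.

(** [L'] denies a search, so its complement is in NP. The search is limited to words no longer than
    the input, which the padding of the program makes long enough. *)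
Lemma coNP_poly_of_cnf (L : language) (B : nat -> nat) :
  poly_bounded B -> (forall n, cnf_def n (B n) (fun x => ~ L x)) -> coNP_poly L.
Proof.
move=> Bpoly /functional_choice[r /functional_choice[f Lf]].
pose advice n := rev (cnf_prog n (r n) (f n)).
pose L' u := ~ exists w, size w <= size u /\ eval_accepts (u, w).
have [p advp] : poly_bounded (fun n => (6 * (n + B n) + 3) * B n + 3 * B n + 3 * n + 3).
  by poly_bound.
exists L', advice, p; split.
- exists eval_accepts, ('X)%R; split; first exact: poly_time_eval.
  by move=> u; rewrite hornerX; split=> [/NNPP|? ?].
- move=> n; apply: leq_trans (advp n); have [rB fb _] := Lf n.
  rewrite size_rev (leq_trans (size_cnf_prog _ _ fb)) //.
  have : (6 * (n + r n) + 3) * cnf_size (f n) <= (6 * (n + B n) + 3) * B n.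
    by rewrite leq_mul //; lia.
  lia.
move=> x; have [rB fb Lx] := Lf (size x).
have {}Lx := Lx x erefl.
split=> [xL [w [_ /(eval_accepts_cnf fb)]]|L'x].
  by rewrite -Lx.
apply: NNPP; rewrite Lx => -[w szw satw]; apply: L'x; exists (x ++ w).
rewrite -szw in fb; split; last by rewrite /advice -szw; apply: cnf_eval_accepts.
rewrite size_cat szw size_enc_pair size_rev /cnf_prog !size_cat !size_repeat_prog /=.
lia.
Qed.

(** * The Fortnow-Santhanam covering argument *)

Section Distillation.

Variables (X Y : finType) (t : nat) (F : {ffun 'I_t -> X} -> Y) (S : {set X}).
Hypotheses (t_gt0 : 0 < t) (cardY : #|Y| <= 2 ^ t).

(** The companions of [x] range over the fixed [S], not over the shrinking set still to be
    covered. *)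
Definition fiber (i : 'I_t) (y : Y) : {set X} :=
  [set x | [exists z : {ffun 'I_t -> X},
              [&& [forall j, z j \in S], z i == x & F z == y]]].

(* Otherwise each value [y] is taken by fewer than [(#|S'| / 2) ^ t] tuples. *)
Lemma large_fiber (S' : {set X}) : S' \subset S -> S' != set0 ->
  exists i y, #|S'| <= 2 * #|S' :&: fiber i y|.
Proof.
move=> sub_S' /set0Pn[x0 x0S']; apply: NNPP => no_fiber.
have small i y : 2 * #|S' :&: fiber i y| <= #|S'|.-1.
  rewrite -ltnS prednK; last by apply/card_gt0P; exists x0.
  by rewrite ltnNge; apply/negP => le; apply: no_fiber; exists i, y.
pose tuples y := [set z in ffun_on (mem S') | F z == y].
have le_tuples y : 2 ^ t * #|tuples y| <= #|S'|.-1 ^ t.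
  have: #|tuples y| <= #|family (fun i => mem (S' :&: fiber i y))|.
    apply: subset_leq_card; apply/subsetP => z; rewrite inE => /andP[zS' Fz].
    apply/familyP => i; rewrite inE (ffun_onP zS') inE.
    apply/existsP; exists z; rewrite eqxx Fz !andbT /=.
    by apply/forallP => j; apply: (subsetP sub_S'); apply: (ffun_onP zS').
  rewrite card_family -(leq_pmul2l (expn_gt0 2 t)) => /leq_trans; apply.
  have prod_small (s : seq 'I_t) : 2 ^ size s *
      foldr muln 1 [seq #|S' :&: fiber i y| | i <- s] <= #|S'|.-1 ^ size s.
    elim: s => //= i s IHs; rewrite !expnS mulnACA; exact: leq_mul.
  have := prod_small (enum 'I_t); rewrite -cardE card_ord /image_mem.
  by congr (_ * foldr muln 1 _ <= _).
have total : #|S'| ^ t = \sum_y #|tuples y|.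
  rewrite -{1}(card_ord t) -card_ffun_on -sum1_card.
  rewrite (partition_big F xpredT) //=; apply: eq_bigr => y _.
  by rewrite /tuples cardsE -sum1_card; apply: eq_bigl => z; rewrite !inE.
(* Summing over at most [2 ^ t] values absorbs one factor [2 ^ t]; the [.-1] retained from the
   strict inequality makes the result contradictory. *)
have: 2 ^ t * #|S'| ^ t <= 2 ^ t * #|S'|.-1 ^ t.
  rewrite total big_distrr /= (leq_trans (leq_sum _ (fun y _ => le_tuples y))) //.
  by rewrite sum_nat_const leq_mul.
rewrite leq_pmul2l ?expn_gt0 // leq_exp2r // leqNgt prednK ?leqnn //.
by apply/card_gt0P; exists x0.
Qed.

(** A greedy choice of large fibers halves [S'] each time. That the fibers are nonempty is recorded
    because a certificate is sound only if its value is taken by a tuple over [S]. *)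
Lemma distillation_cover (n : nat) (S' : {set X}) : S' \subset S -> #|S'| < 2 ^ n ->
  exists A : seq ('I_t * Y), [/\ size A <= n,
    forall i y, (i, y) \in A -> fiber i y != set0
  & forall x, x \in S' -> exists2 iy, iy \in A & x \in fiber iy.1 iy.2].
Proof.
elim: n S' => [|n IHn] S' sub_S' ltS'.
  have /eqP S'0 : S' == set0 by rewrite -cards_eq0 -leqn0 -ltnS.
  by exists [::]; split=> // x; rewrite S'0 inE.
have [->|S'n0] := eqVneq S' set0; first by exists [::]; split=> // x; rewrite inE.
have [i [y large]] := large_fiber sub_S' S'n0.
have [||A [szA An0 Acover]] := IHn (S' :\: fiber i y).
- exact: subset_trans (subsetDl _ _) sub_S'.
- by have := cardsID (fiber i y) S'; rewrite expnS in ltS'; lia.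
exists ((i, y) :: A); split=> //.
  move=> i' y'; rewrite inE => /orP[/eqP[-> ->]|/An0//].
  apply: contraNneq S'n0 => fib0; move: large.
  by rewrite fib0 setI0 cards0 muln0 leqn0 cards_eq0.
move=> x xS'; have [xf|xf] := boolP (x \in fiber i y).
  by exists (i, y); rewrite ?mem_head.
have [|iy iyA xiy] := Acover x; first by rewrite inE xf.
by exists iy; rewrite // inE iyA orbT.
Qed.

Lemma fiberP (i : 'I_t) (y : Y) (x : X) :
  reflect (exists z : {ffun 'I_t -> X}, [/\ forall j, z j \in S, z i = x & F z = y])
          (x \in fiber i y).
Proof.
rewrite inE; apply: (iffP existsP) => -[z].
  by move=> /and3P[/forallP zS /eqP zi /eqP Fz]; exists z.
by move=> [zS zi Fz]; exists z; rewrite zi Fz !eqxx !andbT; apply/forallP.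
Qed.

End Distillation.

(** * From directed to undirected Hamiltonian paths *)

Definition simple_path (V : eqType) (e : rel V) (s : seq V) : bool :=
  if s is x :: p then path e x p && uniq s else false.

Section Split.

Variables (U : finType) (D : rel U).

(* A vertex is split into its entry [None], its middle and its exit [Some true]. *)
Definition split_arc (a b : U * option bool) : bool :=
  match a, b with
  | (u, None), (w, Some false) | (u, Some false), (w, Some true) => u == w
  | (u, Some true), (w, None) => D u w
  | _, _ => false
  end.

Definition split_edge (a b : U * option bool) : bool := split_arc a b || split_arc b a.

Lemma split_edge_sym : symmetric split_edge.
Proof. by move=> a b; rewrite /split_edge orbC. Qed.

Lemma split_edge_irr : irreflexive split_edge.
Proof. by move=> [u [[]|]]. Qed.

Lemma split_path_complete (q : seq U) : simple_path D q -> size q = #|U| ->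
  exists2 s, simple_path split_edge s & size s = 3 * #|U|.
Proof.
pose f u : seq (U * option bool) := [:: (u, None); (u, Some false); (u, Some true)].
move=> qP szq; exists (flatten [seq f u | u <- q]); last first.
  by rewrite -szq; elim: {qP szq} q => //= u q ->; lia.
case: q qP {szq} => //= u q /andP[Dq /andP[uq uniq_q]].
rewrite /split_edge /= !eqxx /=; apply/andP; split.
  elim: q u Dq {uq uniq_q} => //= w q IHq u /andP[Duw /IHq Dq].
  by rewrite Duw /= !eqxx /=.
have notin w (q' : seq U) b : w \notin q' -> (w, b) \notin flatten [seq f u | u <- q'].
  elim: q' => //= w' q' IHq'; rewrite !inE negb_or => /andP[/negPf nww' /IHq'/negPf->].
  by rewrite !xpair_eqE nww'.
rewrite !inE !xpair_eqE !eqxx /= !(negPf (notin _ _ _ uq)) /=.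
elim: q uniq_q {u uq Dq} => //= w q IHq /andP[wq /IHq->].
by rewrite !inE !xpair_eqE !eqxx /= !(negPf (notin _ _ _ wq)).
Qed.

Section Sound.

Variables (s t : U) (P : seq (U * option bool)).
Hypotheses (no_in : forall u, ~~ D u s) (no_out : forall u, ~~ D t u).
Hypotheses (D_irr : forall u, ~~ D u u).
Hypotheses (PP : simple_path split_edge P) (szP : size P = 3 * #|U|).

Let uniqP : uniq P.
Proof. by case: P PP => //= a p /andP[]. Qed.

Let inP a : a \in P.
Proof.
have sub : {subset P <= enum {: U * option bool}} by move=> b _; rewrite mem_enum.
have [|_ ->] := uniq_min_size uniqP sub; last by rewrite mem_enum.
by rewrite szP -cardE card_prod card_option card_bool mulnC.
Qed.

Let idx a := index a P.

Let next a b := (idx b == (idx a).+1) || (idx a == (idx b).+1).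

Let idx_inj : injective idx.
Proof. by move=> a b eq_ab; rewrite -(nth_index a (inP a)) -/(idx a) eq_ab nth_index. Qed.

Let idx_lt a : idx a < size P.
Proof. by rewrite index_mem. Qed.

Let nextC a b : next a b = next b a.
Proof. by rewrite /next orbC. Qed.

Let edge_succ a b : idx b = (idx a).+1 -> split_edge a b.
Proof.
have nthP i : i.+1 < size P -> split_edge (nth a P i) (nth a P i.+1).
  by case: P PP => //= x p /andP[/(pathP a) H _] /H.
move=> eq_b; have := nthP (idx a); rewrite -eq_b idx_lt !nth_index //.
exact.
Qed.

Let next_edge a b : next a b -> split_edge a b.
Proof.
by case/orP => /eqP /edge_succ //; rewrite split_edge_sym.
Qed.

(** A vertex has at most two neighbours on a path; the test on second components is a convenient
    form of [b != c]. *)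
Let next3 a b c d : next a b -> next a c -> next a d -> b.2 != c.2 -> (d == b) || (d == c).
Proof.
rewrite /next => ab ac ad neq2; have: b != c by apply: contraNneq neq2 => ->.
rewrite -!(inj_eq idx_inj).
by move: ab ac ad => /orP[]/eqP ? /orP[]/eqP ? /orP[]/eqP ?; lia.
Qed.

Let next_interior a : 0 < idx a -> (idx a).+1 < size P ->
  exists b c, [/\ next a b, next a c & b != c].
Proof.
move=> a0 asz; exists (nth a P (idx a).-1), (nth a P (idx a).+1).
have idx_nth i : i < size P -> idx (nth a P i) = i by move=> lti; apply: index_uniq.
rewrite /next !idx_nth ?(leq_trans _ asz) ?leq_pred //; last by lia.
rewrite prednK // !eqxx orbT; split=> //.
by rewrite -(inj_eq idx_inj) !idx_nth ?(leq_trans _ asz) //; lia.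
Qed.

Let next_start b : next (s, None) b -> b = (s, Some false).
Proof.
move/next_edge; rewrite /split_edge; case: b => w [[]|] //=.
  by rewrite (negPf (no_in _)).
by rewrite orbF => /eqP->.
Qed.

Let next_end b : next (t, Some true) b -> b = (t, Some false).
Proof.
move/next_edge; rewrite /split_edge; case: b => w [[]|] //=.
  by move/eqP->.
by rewrite orbF (negPf (no_out _)).
Qed.

(** The entry of [s] and the exit of [t] can only be adjacent to their middles, so they are the two
    ends of the path. *)
Let interior a : a != (s, None) -> a != (t, Some true) ->
  exists b c, [/\ next a b, next a c & b != c].
Proof.
have endpoint b : (forall c, next b c -> c = (b.1, Some false)) ->
    idx b = 0 \/ (idx b).+1 = size P.
  move=> one; case: (posnP (idx b)) => [->|b0]; first by left.
  right; apply/eqP; rewrite eqn_leq idx_lt leqNgt; apply/negP => blt.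
  have [c [d [/one-> /one->]]] := next_interior b0 blt.
  by rewrite eqxx.
move=> nas nat; have idx_s := endpoint _ next_start; have idx_t := endpoint _ next_end.
move: nas nat; rewrite -!(inj_eq idx_inj).
have : idx (s, None) != idx (t, Some true) by rewrite (inj_eq idx_inj) xpair_eqE andbF.
have := idx_lt a; move=> lta st nas nat; apply: next_interior; lia.
Qed.

Definition path_arc (u w : U) : bool :=
  let a := (u, Some true) in let b := (w, None) in
  (index b P == (index a P).+1) || (index a P == (index b P).+1).

Let path_arcE u w : path_arc u w = next (u, Some true) (w, None).
Proof. by []. Qed.

(** A middle has only two neighbours in the graph and is interior to the path, so both edges are
    used. *)
Let next_middle u : next (u, Some false) (u, None) /\ next (u, Some false) (u, Some true).
Proof.
have [||b [c [ub uc nbc]]] := @interior (u, Some false); rewrite ?xpair_eqE ?andbF //.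
move: (next_edge ub) (next_edge uc); rewrite /split_edge.
case: b ub nbc => w [[]|] ub nbc //=; case: c uc nbc => w' [[]|] uc nbc //=; rewrite ?orbF.
- by move=> /eqP uw /eqP uw'; rewrite -uw -uw' eqxx in nbc.
- by move=> /eqP uw /eqP wu; rewrite -uw in ub; rewrite wu in uc.
- by move=> /eqP wu /eqP uw; rewrite -uw in uc; rewrite wu in ub.
by move=> /eqP uw /eqP uw'; rewrite uw uw' eqxx in nbc.
Qed.

Lemma path_arc_sub u w : path_arc u w -> D u w.
Proof. by rewrite path_arcE => /next_edge; rewrite /split_edge /= orbF. Qed.

Lemma path_arc_fun u w w' : path_arc u w -> path_arc u w' -> w = w'.
Proof.
rewrite !path_arcE => uw uw'; have [_ um] := next_middle u; rewrite nextC in um.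
by have := next3 um uw uw' isT; rewrite !xpair_eqE /= andbF andbT => /eqP.
Qed.

Lemma path_arc_inj u u' w : path_arc u w -> path_arc u' w -> u = u'.
Proof.
rewrite !path_arcE ![next _ (w, None)]nextC => uw uw'.
have [um _] := next_middle w; rewrite nextC in um.
by have := next3 um uw uw' isT; rewrite !xpair_eqE /= andbF andbT => /eqP.
Qed.

Lemma path_arc_out u : u != t -> exists w, path_arc u w.
Proof.
move=> ut; have [||b [c [ub uc nbc]]] := @interior (u, Some true).
- by rewrite xpair_eqE andbF.
- by rewrite xpair_eqE andbT.
case: b ub nbc => w [[]|] ub nbc; first by have := next_edge ub.
  case: c uc nbc => w' [[]|] uc nbc; first by have := next_edge uc.
    move: nbc (next_edge ub) (next_edge uc).
    by rewrite /split_edge /= => /[swap] /eqP-> /[swap] /eqP->; rewrite eqxx.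
  by exists w'.
by exists w.
Qed.

Lemma path_arc_in w : w != s -> exists u, path_arc u w.
Proof.
move=> ws; have [||b [c [wb wc nbc]]] := @interior (w, None).
- by rewrite xpair_eqE andbT.
- by rewrite xpair_eqE andbF.
case: b wb nbc => u [[]|] wb nbc; first by exists u; rewrite path_arcE nextC.
  case: c wc nbc => u' [[]|] wc nbc; first by exists u'; rewrite path_arcE nextC.
    move: nbc (next_edge wb) (next_edge wc).
    by rewrite /split_edge /= !orbF => /[swap] /eqP<- /[swap] /eqP<-; rewrite eqxx.
  by have := next_edge wc.
by have := next_edge wb.
Qed.

(** Opposite arcs would make the six parts of [u] and [w] closed under [next], hence all of [P];
    then [s] would be one of the two and have an incoming arc. *)
Lemma path_arc_asym u w : path_arc u w -> ~~ path_arc w u.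
Proof.
move=> uw; apply/negP => wu.
have nuw : u != w by apply: contraTneq (path_arc_sub uw) => ->.
pose C (a : U * option bool) := (a.1 == u) || (a.1 == w).
have Cnext a b : C a -> next a b -> C b.
  have [mu mu'] := next_middle u; have [mw mw'] := next_middle w.
  rewrite !path_arcE in uw wu.
  case: a => x o; rewrite {1}/C /= => /orP[]/eqP-> {x}; case: o => [[]|] ab.
  - rewrite nextC in mu'; have := next3 mu' uw ab isT.
    by move=> /orP[]/eqP->; rewrite /C /= eqxx ?orbT.
  - by have := next3 mu mu' ab isT => /orP[]/eqP->; rewrite /C /= eqxx ?orbT.
  - rewrite nextC in mu; rewrite nextC in wu; have := next3 mu wu ab isT.
    by move=> /orP[]/eqP->; rewrite /C /= eqxx ?orbT.
  - rewrite nextC in mw'; have := next3 mw' wu ab isT.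
    by move=> /orP[]/eqP->; rewrite /C /= eqxx ?orbT.
  - by have := next3 mw mw' ab isT => /orP[]/eqP->; rewrite /C /= eqxx ?orbT.
  - rewrite nextC in mw; rewrite nextC in uw; have := next3 mw uw ab isT.
    by move=> /orP[]/eqP->; rewrite /C /= eqxx ?orbT.
have Call a : C a.
  have idx_nth i : i < size P -> idx (nth (u, None) P i) = i.
    by move=> lti; apply: index_uniq.
  have step i : i.+1 < size P -> C (nth (u, None) P i) = C (nth (u, None) P i.+1).
    move=> lti; have nx : next (nth (u, None) P i) (nth (u, None) P i.+1).
      by rewrite /next !idx_nth ?eqxx // ltnW.
    by apply/idP/idP => /Cnext; apply; rewrite // nextC.
  have C0 i : i < size P -> C (nth (u, None) P i) = C (nth (u, None) P 0).
    by elim: i => // i IHi lti; rewrite -step // IHi // ltnW.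
  have := C0 _ (idx_lt a); rewrite nth_index // => ->.
  by have := C0 _ (idx_lt (u, None)); rewrite nth_index // => <-; rewrite /C eqxx.
have := Call (s, None); rewrite /C /= => /orP[]/eqP eq_s.
  by have := no_in w; rewrite eq_s (path_arc_sub wu).
by have := no_in u; rewrite eq_s (path_arc_sub uw).
Qed.

End Sound.
End Split.

(** * From satisfiability to directed Hamiltonian paths *)

Section SatGraph.

(* [inc j i b]: the literal of variable [i] with sign [b] occurs in clause [j]. *)
Variables (v0 m : nat) (inc : 'I_m -> 'I_v0.+1 -> bool -> bool).

Local Notation L := (3 * m + 2).

(* Hubs, the positions [0, ..., L] of the row of each variable, and clauses.  A
   Hamiltonian path follows the row [i] from the hub [i] to the hub [i + 1] in
   either direction; the rightward direction, which stands for [true], may visit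
   the clause [j] between the positions [3 * j + 2] and [3 * j + 3] if the
   variable occurs positively in it, and the leftward one if it occurs
   negatively.  The positions [3 * j + 1] are buffers, which force a path that
   leaves the row for a clause to come back to the same row. *)
Definition sat_vertex : finType := ('I_v0.+2 + 'I_v0.+1 * 'I_L.+1 + 'I_m)%type.

Definition hub (i : nat) : sat_vertex := inl (inl (inord i)).
Definition row (i : 'I_v0.+1) (p : nat) : sat_vertex := inl (inr (i, inord p)).
Definition clause (j : 'I_m) : sat_vertex := inr j.

Definition sat_arc (a b : sat_vertex) : bool :=
  match a, b with
  | inl (inl h), inl (inr (i, p)) => (h == i :> nat) && ((p == 0 :> nat) || (p == L :> nat))
  | inl (inr (i, p)), inl (inl h) => (h == i.+1 :> nat) && ((p == 0 :> nat) || (p == L :> nat))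
  | inl (inr (i, p)), inl (inr (i', p')) =>
      (i == i') && ((p' == p.+1 :> nat) || (p == p'.+1 :> nat))
  | inl (inr (i, p)), inr j =>
      (p == 3 * j + 2 :> nat) && inc j i true || (p == 3 * j + 3 :> nat) && inc j i false
  | inr j, inl (inr (i, p)) =>
      (p == 3 * j + 3 :> nat) && inc j i true || (p == 3 * j + 2 :> nat) && inc j i false
  | _, _ => false
  end.

Lemma card_sat_vertex : #|sat_vertex| = v0.+2 + v0.+1 * L.+1 + m.
Proof. by rewrite !card_sum card_prod !card_ord. Qed.

Lemma sat_arc_hub0 a : ~~ sat_arc a (hub 0).
Proof. by case: a => [[h|[i p]]|j] //=; rewrite inordK. Qed.

Lemma sat_arc_hubv a : ~~ sat_arc (hub v0.+1) a.
Proof.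
case: a => [[h|[i p]]|j] //=; rewrite inordK //.
by have := ltn_ord i; lia.
Qed.

Lemma sat_arc_irr a : ~~ sat_arc a a.
Proof. by case: a => [[h|[i p]]|j] //=; lia. Qed.

Section Sound.

Variable E : rel sat_vertex.
Hypotheses (E_sub : forall a b, E a b -> sat_arc a b)
  (E_fun : forall a b b', E a b -> E a b' -> b = b')
  (E_inj : forall a a' b, E a b -> E a' b -> a = a')
  (E_out : forall a, a != hub v0.+1 -> exists b, E a b)
  (E_in : forall b, b != hub 0 -> exists a, E a b)
  (E_asym : forall a b, E a b -> ~~ E b a).

Let row_inj i p p' : p <= L -> p' <= L -> row i p = row i p' -> p = p'.
Proof.
move=> lep lep' [/(congr1 val)]; rewrite /= !inordK //.
Qed.

Let row_arcs i l p q a : l.+1 = p -> p.+1 = q -> q <= L ->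
  (E (row i p) a -> [\/ a = row i l, a = row i q
     | exists2 j, a = clause j & (p == 3 * j + 2) || (p == 3 * j + 3)]) /\
  (E a (row i p) -> [\/ a = row i l, a = row i q
     | exists2 j, a = clause j & (p == 3 * j + 2) || (p == 3 * j + 3)]).
Proof.
move=> El Eq leq; have ltp : p < L.+1 by lia.
have nbr i' (p' : 'I_L.+1) d : d <= L -> i = i' -> p' = d :> nat -> inl (inr (i', p')) = row i d.
  move=> led <- Ed; rewrite /row; congr (inl (inr (_, _))).
  by apply: val_inj; rewrite /= inordK.
split=> /E_sub.
  case: a => [[h|[i' p']]|j] /=; rewrite inordK //; first lia.
    case/andP=> /eqP eqi /orP[]/eqP Ep; [constructor 2|constructor 1]; apply: nbr => //; lia.
  by move=> H; constructor 3; exists j => //; case/orP: H => /andP[-> _]; rewrite ?orbT.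
case: a => [[h|[i' p']]|j] /=; rewrite inordK //; first lia.
  case/andP=> /eqP eqi /orP[]/eqP Ep; [constructor 1|constructor 2]; apply: nbr => //; lia.
by move=> H; constructor 3; exists j => //; case/orP: H => /andP[-> _]; rewrite ?orbT.
Qed.

(** A buffer has no clause as neighbour, and by [E_asym] it is not entered and left on the same
    side. The case [j = m] is the buffer after the last clause. *)
Let separator i j l p q : j <= m -> p = 3 * j + 1 -> l.+1 = p -> p.+1 = q ->
  (E (row i l) (row i p) /\ E (row i p) (row i q)) \/
  (E (row i q) (row i p) /\ E (row i p) (row i l)).
Proof.
move=> lejm Ep El Eq; have leq : q <= L by lia.
have [b Eb] : exists b, E (row i p) b by apply: E_out.
have [a Ea] : exists a, E a (row i p) by apply: E_in.
have [_ /(_ Ea) Ha] := row_arcs i a El Eq leq.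
have [/(_ Eb) Hb _] := row_arcs i b El Eq leq.
case: Ha => [Ha|Ha|[j' _]]; last by lia.
- case: Hb => [Hb|Hb|[j' _]]; last by lia.
    by have := E_asym Ea; rewrite Ha -Hb Eb.
  by left; rewrite -Ha -Hb.
case: Hb => [Hb|Hb|[j' _]]; last by lia.
  by right; rewrite -Ha -Hb.
by have := E_asym Ea; rewrite Ha -Hb Eb.
Qed.

Let rightward i (j : nat) : bool := E (row i (3 * j + 1)) (row i (3 * j + 2)).

Let rightwardE i j p q : p = 3 * j + 1 -> p.+1 = q -> rightward i j = E (row i p) (row i q).
Proof. by move=> Ep <-; rewrite /rightward Ep (addnS _ 1). Qed.

(** Between two buffers lie two positions, with access to the clause [j] only. If the directions
    differed, both positions would have this clause as predecessor, or both as successor, against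
    [E_fun] or [E_inj]. *)
Let rightward_succ i (j : nat) : j < m -> rightward i j = rightward i j.+1.
Proof.
move=> ltjm; pose jo := Ordinal ltjm.
have [p Ep] : exists p, p = 3 * j + 1 by exists (3 * j + 1).
have Ep4 : p.+3 = 3 * j.+1 + 1 by lia.
have [l El] : exists l, l.+1 = p by exists (3 * j); lia.
have := separator i (ltnW ltjm) Ep El erefl.
have := separator i ltjm Ep4 erefl erefl.
rewrite (rightwardE i Ep erefl) (rightwardE i Ep4 erefl).
have leL : p.+4 <= L by lia.
have neq c d : row i (c + p) = row i (d + p) -> c <= 4 -> d <= 4 -> c = d.
  by move=> eq_row lec led; have := @row_inj i (c + p) (d + p) ltac:(lia) ltac:(lia) eq_row; lia.
have asym a b : E a b -> E b a -> False by move=> /E_asym/negP.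
have a_arcs c : (E (row i p.+1) c -> [\/ c = row i p, c = row i p.+2 | c = clause jo]) /\
    (E c (row i p.+1) -> [\/ c = row i p, c = row i p.+2 | c = clause jo]).
  have [|H1 H2] := @row_arcs i p p.+1 p.+2 c erefl erefl; first lia.
  split=> [/H1|/H2] [->|->|[j' -> Hj']]; try by [constructor 1|constructor 2];
  by constructor 3; congr clause; apply: val_inj => /=; lia.
have b_arcs c : (E (row i p.+2) c -> [\/ c = row i p.+1, c = row i p.+3 | c = clause jo]) /\
    (E c (row i p.+2) -> [\/ c = row i p.+1, c = row i p.+3 | c = clause jo]).
  have [|H1 H2] := @row_arcs i p.+1 p.+2 p.+3 c erefl erefl; first lia.
  split=> [/H1|/H2] [->|->|[j' -> Hj']]; try by [constructor 1|constructor 2];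
  by constructor 3; congr clause; apply: val_inj => /=; lia.
have [ca Ea] : exists c, E (row i p.+1) c by apply: E_out.
have [cb Eb] : exists c, E (row i p.+2) c by apply: E_out.
have [da Da] : exists c, E c (row i p.+1) by apply: E_in.
have [db Db] : exists c, E c (row i p.+2) by apply: E_in.
move=> [[Hb Hs']|[Hs' Hb]] [[Hs Ha]|[Ha Hs]].
- by rewrite Ha Hs'.
- exfalso.
  have [_ /(_ Da)[Eda|Eda|Eda]] := a_arcs da; subst da; first exact: asym Ha Da.
    by have := neq 3 1 (E_fun Hb Da) isT isT.
  have [_ /(_ Db)[Edb|Edb|Edb]] := b_arcs db; subst db; last first.
  + by have := neq 1 2 (E_fun Da Db) isT isT.
  + exact: asym Hb Db.
  by have := neq 0 2 (E_fun Ha Db) isT isT.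
- exfalso.
  have [/(_ Ea)[Eca|Eca|Eca] _] := a_arcs ca; subst ca; first exact: asym Ha Ea.
    by have := neq 3 1 (E_inj Hb Ea) isT isT.
  have [/(_ Eb)[Ecb|Ecb|Ecb] _] := b_arcs cb; subst cb; last first.
  + by have := neq 1 2 (E_inj Ea Eb) isT isT.
  + exact: asym Hb Eb.
  by have := neq 0 2 (E_inj Ha Eb) isT isT.
by apply/idP/idP => H; exfalso; [apply: asym Ha H | apply: asym Hs' H].
Qed.

Lemma sat_graph_sound : exists alpha : 'I_v0.+1 -> bool,
  forall j, exists i, inc j i (alpha i).
Proof.
exists (fun i => rightward i 0) => j.
have rightward0 i k : k <= m -> rightward i 0 = rightward i k.
  elim: k => [//|k IHk ltkm].
  exact: etrans (IHk (ltnW ltkm)) (rightward_succ i ltkm).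
have [a Ea] : exists a, E a (clause j) by apply: E_in.
have := E_sub Ea; case: a Ea => [[h|[i p]]|j'] //= Ea H; exists i.
have Ep : row i p = inl (inr (i, p)) by rewrite /row inord_val.
rewrite -Ep in Ea; clear Ep; have ltjm := ltn_ord j.
have [p' Ep'] : exists p', p' = p :> nat by exists p.
rewrite -!Ep' in H Ea; case/orP: H => /andP[/eqP Ep2 incj].
  rewrite (rightward0 i j) ?(ltnW ltjm) //.
  have Esep : 3 * j + 1 = 3 * j + 1 by [].
  have [l El] : exists l, l.+1 = 3 * j + 1 by exists (3 * j); rewrite addn1.
  have Eq : (3 * j + 1).+1 = p' by lia.
  rewrite (rightwardE i Esep Eq).
  have [[_ ->]//|[H _]] := separator i (ltnW ltjm) Esep El Eq.
  by have := E_fun H Ea.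
(* The position [3 * j + 3] has its buffer on the right, so the direction is read at buffer
   [j.+1]. *)
rewrite (rightward0 i j.+1) //.
have Esep : p'.+1 = 3 * j.+1 + 1 by lia.
rewrite (rightwardE i Esep erefl); case: (boolP (E _ _)) => // Er; exfalso.
have [[H _]|[H _]] := separator i ltjm Esep erefl erefl.
  by have := E_fun H Ea.
by have := E_asym H; rewrite Er.
Qed.

End Sound.

Section Complete.

Variables (alpha : 'I_v0.+1 -> bool) (w : 'I_m -> 'I_v0.+1).
Hypothesis incw : forall j, inc j (w j) (alpha (w j)).

Let ins (i : 'I_v0.+1) (p : nat) : seq sat_vertex :=
  map clause (filter (fun j : 'I_m => (p == 3 * j + 2) && (w j == i)) (enum 'I_m)).

Let row_path i : seq sat_vertex := flatten [seq row i p :: ins i p | p <- iota 0 L.+1].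

Let segment (i : nat) : seq sat_vertex :=
  (if alpha (inord i) then row_path (inord i) else rev (row_path (inord i))) ++
  [:: hub i.+1].

Let ham : seq sat_vertex := hub 0 :: flatten [seq segment i | i <- iota 0 v0.+1].

Let insP i p : ins i p = [::] \/
  exists j : 'I_m, [/\ ins i p = [:: clause j], p = 3 * j + 2 & w j = i].
Proof.
rewrite /ins; set P := (P in filter P).
have: uniq (filter P (enum 'I_m)) by rewrite filter_uniq ?enum_uniq.
have: all P (filter P (enum 'I_m)) by apply: filter_all.
case: (filter P _) => [|j [|j' s]] /=; first by left.
  by move=> /andP[/andP[/eqP-> /eqP<-] _] _; right; exists j.
move=> /and3P[/andP[/eqP p_j _] /andP[/eqP p_j' _] _].
have -> : j' = j by apply: val_inj => /=; lia.
by rewrite mem_head.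
Qed.

(** The relation is arbitrary because a leftward row is the reverse of a path for the converse of
    [sat_arc]. *)
Let row_path_fwd (e : rel sat_vertex) i :
  (forall p, p < L -> e (row i p) (row i p.+1)) ->
  (forall j, w j = i -> e (row i (3 * j + 2)) (clause j)
                        /\ e (clause j) (row i (3 * j + 3))) ->
  exists q, [/\ row_path i = row i 0 :: q, path e (row i 0) q
              & last (row i 0) q = row i L].
Proof.
move=> e_row e_clause.
have main k p : p + k = L -> let q := ins i p ++
    flatten [seq row i p' :: ins i p' | p' <- iota p.+1 k] in
    path e (row i p) q /\ last (row i p) q = row i L.
  elim: k p => [|k IHk] p eq_L /=.
    rewrite addn0 in eq_L; have [->|[j [_ Ep _]]] := insP i p; first by rewrite eq_L.
    by have := ltn_ord j; lia.
  have [IH1 IH2] := IHk p.+1 ltac:(lia).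
  have [->|[j [-> Ep wj]]] := insP i p.
    by rewrite cat0s /= e_row ?IH1 //; lia.
  have [e1 e2] := e_clause j wj.
  have Eq : p.+1 = 3 * j + 3 by lia.
  rewrite -Ep in e1; rewrite -Eq in e2.
  by rewrite cat1s /= e1 e2 IH1.
have [//|H1 H2] := main L 0; eexists; split; [|exact: H1|exact: H2].
by rewrite /row_path.
Qed.

Let segment_path (i : nat) : i < v0.+1 ->
  path sat_arc (hub i) (segment i) /\ last (hub i) (segment i) = hub i.+1.
Proof.
move=> lti; rewrite /segment last_cat; split=> //.
set o := inord i; have o_i : o = i :> nat by rewrite inordK.
have arcs p : p < L -> sat_arc (row o p) (row o p.+1) /\ sat_arc (row o p.+1) (row o p).
  by move=> ltp; rewrite /= eqxx !inordK ?eqxx ?orbT //; lia.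
have arcs0 : sat_arc (hub i) (row o 0) /\ sat_arc (row o 0) (hub i.+1).
  by rewrite /= o_i !inordK //; try lia; rewrite !eqxx.
have arcsL : sat_arc (hub i) (row o L) /\ sat_arc (row o L) (hub i.+1).
  by rewrite /= o_i !inordK //; try lia; rewrite !eqxx !orbT.
have inordj (j : 'I_m) d : d <= 3 -> (inord (3 * j + d) : 'I_L.+1) = 3 * j + d :> nat.
  by move=> led; rewrite inordK //; have := ltn_ord j; lia.
case: ifP => alpha_o.
  have [|j wj|q [-> q_path q_last]] := @row_path_fwd sat_arc o.
  - by move=> p /arcs[].
  - by move: (incw j); rewrite wj alpha_o /= !inordj // !eqxx => ->; rewrite ?orbT.
  by rewrite cat_path /= q_last /= q_path; move: arcs0 arcsL => /= [-> _] [_ ->].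
have [|j wj|q [-> q_path q_last]] := @row_path_fwd (fun a b => sat_arc b a) o.
- by move=> p /arcs[].
- by move: (incw j); rewrite wj alpha_o /= !inordj // !eqxx => ->; rewrite ?orbT.
rewrite lastI rev_rcons cat_path /= q_last; rewrite -q_last rev_path q_path q_last.
have -> : last (row o L) (rev (belast (row o 0) q)) = row o 0.
  by case: q {q_path} q_last => [|a q] //= ; rewrite rev_cons last_rcons.
by move: arcs0 arcsL => /= [_ ->] [-> _].
Qed.

Let ham_path : path sat_arc (hub 0) (behead ham).
Proof.
have main k i : i + k <= v0.+1 ->
    path sat_arc (hub i) (flatten [seq segment i | i <- iota i k]).
  elim: k i => [//|k IHk] i leik.
  rewrite [flatten _]/= cat_path; have [|H1 H2] := @segment_path i; first lia.
  by rewrite H1 H2; apply: IHk; rewrite addSnnS.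
exact: (main v0.+1 0).
Qed.

Let mem_ham a : a \in ham.
Proof.
have seg i a' : i < v0.+1 -> a' \in segment i -> a' \in ham.
  move=> lti ai; rewrite inE; apply/orP; right; apply/flattenP.
  by exists (segment i) => //; apply/mapP; exists i; rewrite ?mem_iota.
have in_row i a' : a' \in row_path i -> a' \in ham.
  move=> ai; apply: (seg i); first exact: ltn_ord.
  by rewrite /segment inord_val mem_cat; case: ifP => _; rewrite ?mem_rev ai.
case: a => [[h|[i p]]|j].
- case: (posnP h) => [h0|h_gt0].
    have -> : inl (inl h) = hub 0; last exact: mem_head.
    by congr (inl (inl _)); apply: val_inj; rewrite /= inordK.
  apply: (seg h.-1); first by have := ltn_ord h; lia.
  rewrite /segment mem_cat prednK // mem_seq1; apply/orP; right.
  by rewrite /hub inord_val.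
- apply: (in_row i); apply/flattenP; exists (row i p :: ins i p).
    by apply/mapP; exists (nat_of_ord p); rewrite // mem_iota ltn_ord.
  by rewrite /row inord_val mem_head.
apply: (in_row (w j)); apply/flattenP.
exists (row (w j) (3 * j + 2) :: ins (w j) (3 * j + 2)).
  by apply/mapP; exists (3 * j + 2); rewrite // mem_iota; have := ltn_ord j; lia.
rewrite inE; apply/orP; right; apply/mapP; exists j => //.
by rewrite mem_filter mem_enum !eqxx.
Qed.

(** Counting replaces a direct proof of uniqueness: a list that contains every vertex and is no
    longer than their number has no repetition. *)
Let size_ham : size ham <= #|sat_vertex|.
Proof.
have size_ins i p : size (ins i p) = \sum_(j < m) ((p == 3 * j + 2) && (w j == i)).
  by rewrite size_map size_filter -sumn_count sumnE big_map big_enum.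
have iota_ord n (G : nat -> nat) : \sum_(i <- iota 0 n) G i = \sum_(i < n) G i.
  by rewrite -(subn0 n) -/(index_iota 0 n) big_mkord subn0.
have size_segment i : size (segment i) =
    L.+2 + \sum_(p < L.+1) size (ins (inord i) p).
  rewrite /segment size_cat; have -> : size (if alpha (inord i) then
      row_path (inord i) else rev (row_path (inord i))) = size (row_path (inord i)).
    by case: ifP; rewrite ?size_rev.
  rewrite size_flatten /shape -map_comp sumnE big_map iota_ord /=.
  under eq_bigr do rewrite -add1n.
  by rewrite big_split /= sum_nat_const card_ord muln1 addn1 addSn addnC addSn addnC.
have total : \sum_(i < v0.+1) \sum_(p < L.+1) size (ins i p) = m.
  under eq_bigr => i _ do under eq_bigr => p _ do rewrite size_ins.
  under eq_bigr do rewrite exchange_big /=.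
  rewrite exchange_big /= -[RHS]card_ord -sum1_card; apply: eq_bigr => j _.
  have ltp : 3 * j + 2 < L.+1 by have := ltn_ord j; lia.
  rewrite (bigD1 (w j)) //= (bigD1 (Ordinal ltp)) //= !eqxx !big1 //.
    by move=> i /negPf nij; apply: big1 => p _; rewrite [w j == i]eq_sym nij andbF.
  by move=> p; rewrite -(inj_eq val_inj) /= => /negPf->.
have -> : size ham = (size (flatten [seq segment i | i <- iota 0 v0.+1])).+1 by [].
rewrite card_sat_vertex size_flatten /shape -map_comp sumnE big_map iota_ord.
under eq_bigr => i _ do rewrite /= size_segment inord_val.
by rewrite big_split /= total sum_nat_const card_ord mulnSr; lia.
Qed.

Lemma sat_graph_complete : exists2 q, simple_path sat_arc q & size q = #|sat_vertex|.
Proof.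
have ham_uniq : uniq ham.
  apply: (@leq_size_uniq _ (enum sat_vertex)); first exact: enum_uniq.
    by move=> a _; apply: mem_ham.
  by rewrite -cardE size_ham.
exists ham; first by apply/andP; split; [exact: ham_path | exact: ham_uniq].
by apply/eqP; rewrite eqn_leq size_ham cardE uniq_leq_size ?enum_uniq.
Qed.

End Complete.
End SatGraph.

Lemma sat_graph_path (v0 m : nat) (inc : 'I_m -> 'I_v0.+1 -> bool -> bool) :
  (exists2 s, simple_path (split_edge (sat_arc inc)) s & 3 * #|sat_vertex v0 m| <= size s)
  <-> (exists alpha : 'I_v0.+1 -> bool, forall j, exists i, inc j i (alpha i)).
Proof.
split=> [[s sP szs]|[alpha sat_alpha]].
  have szs' : size s = 3 * #|sat_vertex v0 m|.
    apply/eqP; rewrite eqn_leq szs andbT; have : uniq s by case: s sP {szs} => // a s /andP[].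
    move=> /card_uniqP <-; rewrite (leq_trans (max_card _)) //.
    by rewrite card_prod card_option card_bool mulnC.
  have no_in := @sat_arc_hub0 v0 m inc; have no_out := @sat_arc_hubv v0 m inc.
  have irr := @sat_arc_irr v0 m inc.
  apply: (@sat_graph_sound _ _ _ (path_arc s)).
  - exact: path_arc_sub sP szs'.
  - exact: path_arc_fun no_in no_out sP szs'.
  - exact: path_arc_inj no_in no_out sP szs'.
  - exact: path_arc_out no_in no_out sP szs'.
  - exact: path_arc_in no_in no_out sP szs'.
  exact: path_arc_asym no_in no_out irr sP szs'.
have /functional_choice[w incw] := sat_alpha.
have [q qP szq] := @sat_graph_complete v0 m inc alpha w incw.
by have [s sP szs] := split_path_complete qP szq; exists s; rewrite ?szs.
Qed.

(** * The graph of a CNF, with the input given by unit clauses *)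

Definition projection_bit (z : nat) (F : bits -> bool) : Prop :=
  exists l, plit_bounded z l /\ forall u, F u = plit_val u l.

Lemma projection_bit_const (z : nat) (b : bool) : projection_bit z (fun => b).
Proof. by exists (inl b). Qed.

Lemma projection_bit_ext (z : nat) (F G : bits -> bool) :
  F =1 G -> projection_bit z F -> projection_bit z G.
Proof. by move=> FG [l [lz Fl]]; exists l; split=> // u; rewrite -FG. Qed.

Section CnfGraph.

Variables (n r : nat) (f : cnf).

Local Notation m := (size f + n).

(* The variable [n + r] is a dummy that makes the set of variables nonempty. *)
Definition cnf_inc (x : bits) (j : 'I_m) (i : 'I_(n + r).+1) (b : bool) : bool :=
  if j < size f then ((i : nat), b) \in nth [::] f j
  else (i == j - size f :> nat) && (b == nth false x (j - size f)).

Definition cnf_vertex : finType := (sat_vertex (n + r) m * option bool)%type.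

Definition cnf_edge (x : bits) : rel cnf_vertex := split_edge (sat_arc (cnf_inc x)).

Lemma card_cnf_vertex :
  #|cnf_vertex| = 3 * ((n + r).+2 + (n + r).+1 * (3 * m + 2).+1 + m).
Proof. by rewrite card_prod card_sat_vertex card_option card_bool mulnC. Qed.

Lemma cnf_inc_projection j i b : projection_bit n (fun x => cnf_inc x j i b).
Proof.
rewrite /cnf_inc; case: ltnP => [_|gej]; first exact: projection_bit_const.
case: (_ == _ :> nat); last exact: projection_bit_const.
(* Comparing an input bit with [b] negates it exactly if [b] is false. *)
exists (inr (j - size f, ~~ b)); split=> [|x /=]; first by rewrite /= ltn_subLR.
by case: b; case: nth.
Qed.

(** The two disjuncts of an arc between a row and a clause concern different positions, so a given
    pair of vertices depends on one incidence at most. *)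
Lemma sat_arc_projection a b : projection_bit n (fun x => sat_arc (cnf_inc x) a b).
Proof.
case: a b => [[h|[i p]]|j] [[h'|[i' p']]|j'] /=; try exact: projection_bit_const.
- case: (eqVneq (nat_of_ord p) (3 * j' + 2)) => [->|_] /=.
    have -> : (3 * j' + 2 == 3 * j' + 3) = false by lia.
    by apply: projection_bit_ext (cnf_inc_projection j' i true) => x; rewrite orbF.
  by case: (_ == _ :> nat); [exact: cnf_inc_projection | exact: projection_bit_const].
case: (eqVneq (nat_of_ord p') (3 * j + 3)) => [->|_] /=.
  have -> : (3 * j + 3 == 3 * j + 2) = false by lia.
  by apply: projection_bit_ext (cnf_inc_projection j i' true) => x; rewrite orbF.
by case: (_ == _ :> nat); [exact: cnf_inc_projection | exact: projection_bit_const].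
Qed.

Lemma cnf_edge_projection a b : projection_bit n (fun x => cnf_edge x a b).
Proof.
case: a b => [u [[]|]] [w [[]|]]; rewrite /cnf_edge /split_edge /=;
  try exact: projection_bit_const; last exact: sat_arc_projection.
by apply: projection_bit_ext (sat_arc_projection u w) => x; rewrite orbF.
Qed.

Lemma cnf_edge_sym (x : bits) : symmetric (cnf_edge x).
Proof. exact: split_edge_sym. Qed.

Lemma cnf_edge_irr (x : bits) : irreflexive (cnf_edge x).
Proof. exact: split_edge_irr. Qed.

Hypothesis fb : cnf_bounded (n + r) f.

Lemma cnf_graph_path (x : bits) : size x = n ->
  (exists2 s, simple_path (cnf_edge x) s & #|cnf_vertex| <= size s) <->
  (exists2 w, size w = r & sat (x ++ w) f).
Proof.
move=> szx; rewrite card_prod mulnC card_option card_bool.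
rewrite (sat_graph_path (cnf_inc x)); split=> [[alpha sat_alpha]|[w szw sat_w]].
  have alpha_x (i : 'I_(n + r).+1) : i < n -> alpha i = nth false x i.
    move=> ltin; have ltj : size f + i < m by rewrite ltn_add2l.
    have [i'] := sat_alpha (Ordinal ltj); rewrite /cnf_inc /= ltnNge leq_addr /= addKn.
    by case/andP=> /eqP eqi /eqP <-; congr alpha; apply: val_inj.
  exists (mkseq (fun i => alpha (inord (n + i))) r); first by rewrite size_mkseq.
  apply/(all_nthP [::]) => j ltj; have ltjm : j < m by rewrite ltn_addr.
  have [i] := sat_alpha (Ordinal ltjm); rewrite /cnf_inc /= ltj => lit_i.
  apply/hasP; exists (nat_of_ord i, alpha i) => //; rewrite /sat_lit /= nth_cat szx.
  have lti : i < n + r.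
    by have /allP/(_ _ (mem_nth [::] ltj))/allP/(_ _ lit_i) := fb.
  case: ltnP => [ltin|leni]; first by rewrite alpha_x.
  rewrite nth_mkseq ?subnKC ?inord_val //; lia.
exists (fun i => nth false (x ++ w) i) => j; rewrite /cnf_inc.
case: ltnP => [ltj|gej].
  have /allP/(_ _ (mem_nth [::] ltj))/hasP[[i b] lit_i] := sat_w.
  rewrite /sat_lit /= => /eqP sat_i.
  have lti : i < (n + r).+1.
    by have /allP/(_ _ (mem_nth [::] ltj))/allP/(_ _ lit_i) := fb; apply: leqW.
  by exists (Ordinal lti); rewrite /= sat_i.
have ltj : j - size f < n by have := ltn_ord j; lia.
have lti : j - size f < (n + r).+1 by rewrite ltnS ltnW // ltn_addr.
by exists (Ordinal lti); rewrite /= eqxx nth_cat szx ltj eqxx.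
Qed.

End CnfGraph.

(** * Composed instances *)

Section RelGraph.

Variables (V : finType) (E : rel V).
Hypotheses (E_sym : symmetric E) (E_irr : irreflexive E).

Definition rel_edges : {set {set 'I_#|V|}} :=
  [set [set xy.1; xy.2] | xy : 'I_#|V| * 'I_#|V| & E (enum_val xy.1) (enum_val xy.2)].

Lemma rel_edges_card2 : [forall f in rel_edges, #|f| == 2].
Proof.
apply/forall_inP => f /imsetP[[x y]]; rewrite inE /= => Exy ->.
have nxy : x != y by apply: contraTneq Exy => ->; rewrite (E_irr (enum_val y)).
by rewrite cards2 nxy.
Qed.

Definition rel_graph : graph := Graph rel_edges_card2.

Lemma adj_rel_graph (x y : 'I_#|V|) :
  @adj rel_graph x y = E (enum_val x) (enum_val y).
Proof.
apply/imsetP/idP => [[[x' y']]|Exy]; last by exists (x, y); rewrite ?inE.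
rewrite inE /= => Exy eq_xy.
have := set21 x y; have := set22 x y; rewrite eq_xy !inE.
have := set21 x' y'; have := set22 x' y'; rewrite -eq_xy !inE.
by do 4![case/orP=> /eqP ?]; subst; rewrite // E_sym.
Qed.

End RelGraph.

(** The list of literals also fixes the length of [F u], so one running time serves all [u]. *)
Definition projection (z : nat) (F : bits -> bits) : Prop :=
  exists lits, all (plit_bounded z) lits /\ forall u, F u = [seq plit_val u l | l <- lits].

Lemma projection_const (z : nat) (s : bits) : projection z (fun => s).
Proof.
exists [seq inl b | b <- s]; split; first by elim: s.
by move=> u; rewrite -map_comp map_id.
Qed.

Lemma projection_cat (z : nat) (F G : bits -> bits) :
  projection z F -> projection z G -> projection z (fun u => F u ++ G u).
Proof.
move=> [l [lz Fl]] [l' [lz' Gl']]; exists (l ++ l'); rewrite all_cat lz lz'.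
by split=> // u; rewrite map_cat Fl Gl'.
Qed.

Lemma projection_matrix (z N : nat) (A : bits -> rel 'I_N) :
  (forall x y, projection_bit z (fun u => A u x y)) ->
  projection z (fun u => [seq A u x y | x <- enum 'I_N, y <- enum 'I_N]).
Proof.
move=> Abit; have [g gP] := @functional_choice ('I_N * 'I_N) plit
  (fun xy l => plit_bounded z l /\ forall u, A u xy.1 xy.2 = plit_val u l)
  (fun xy => Abit xy.1 xy.2).
exists [seq g (x, y) | x <- enum 'I_N, y <- enum 'I_N]; split.
  by apply/allP => _ /allpairsP[[x y] /= [_ _ ->]]; case: (gP (x, y)).
move=> u; rewrite map_allpairs; apply: eq_allpairs => x y; rewrite /=.
by case: (gP (x, y)).
Qed.

Section Composition.

Variables (t n : nat) (W : finType) (e : bits -> rel W) (k : nat).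
Hypotheses (e_sym : forall x, symmetric (e x)) (e_irr : forall x, irreflexive (e x)).

Definition block (u : bits) (i : nat) : bits := take n (drop (i * n) u).

Definition union_vertex : finType := ('I_t * W + bool)%type.

(* The disjoint union of the graphs of the blocks of [u] and of two more vertices,
   which are adjacent iff [b]. *)
Definition union_edge (b : bool) (u : bits) : rel union_vertex := fun x y =>
  match x, y with
  | inl (i, a), inl (j, c) => (i == j) && e (block u i) a c
  | inr b1, inr b2 => b && (b1 != b2)
  | _, _ => false
  end.

Lemma union_edge_sym b u : symmetric (union_edge b u).
Proof.
move=> [[i a]|b1] [[j c]|b2] //=; last by rewrite eq_sym.
by rewrite eq_sym; case: eqVneq => //= ->; rewrite e_sym.
Qed.

Lemma union_edge_irr b u : irreflexive (union_edge b u).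
Proof. by move=> [[i a]|b1] /=; rewrite ?e_irr ?eqxx andbF. Qed.

Definition extra (b : bool) : 'I_#|union_vertex| := enum_rank (inr b : union_vertex).

Definition is_edge_deletion (lm : modification) : bool :=
  if lm is EdgeDeletion then true else false.

Definition union_graph (lm : modification) (u : bits) : graph :=
  rel_graph (@union_edge_irr (is_edge_deletion lm) u).

Definition modified_graph (lm : modification) (u : bits) : graph :=
  match lm with
  | EdgeDeletion => @delete_edge (union_graph lm u) [set extra false; extra true]
  | VertexDeletion => @delete_vertex (union_graph lm u) (extra false)
  end.

Lemma union_graph_modified (lm : modification) (u : bits) :
  modified lm (union_graph lm u) (modified_graph lm u).
Proof.
case: lm => /=; last by exists (extra false).
exists [set extra false; extra true] => //; apply/imsetP.
by exists (extra false, extra true); rewrite // inE /= !enum_rankK.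
Qed.

Lemma adj_union_graph lm u (x y : 'I_#|union_vertex|) :
  @adj (union_graph lm u) x y =
  union_edge (is_edge_deletion lm) u (enum_val x) (enum_val y).
Proof. exact: adj_rel_graph (@union_edge_sym _ u) _ _ _. Qed.

Definition modified_nverts (lm : modification) : nat :=
  if is_edge_deletion lm then #|union_vertex| else #|union_vertex|.-1.

Lemma nverts_modified_graph lm u : nverts (modified_graph lm u) = modified_nverts lm.
Proof. by case: lm. Qed.

(** This embedding gives both modifications a common proof: the extra vertices that remain, two or
    one, are isolated. *)
Definition modified_val (lm : modification) (u : bits) :
    'I_(nverts (modified_graph lm u)) -> union_vertex :=
  match lm with
  | EdgeDeletion => fun x => enum_val x
  | VertexDeletion => fun x => enum_val (lift (extra false) x)
  end.

Lemma modified_val_inj lm u : injective (@modified_val lm u).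
Proof.
case: lm => /= x y; first exact: enum_val_inj.
by move/enum_val_inj/lift_inj.
Qed.

Lemma adj_modified_graph lm u x y : @adj (modified_graph lm u) x y =
  union_edge false u (modified_val x) (modified_val y).
Proof.
case: lm x y => x y.
  rewrite /adj !inE -/(@adj (union_graph EdgeDeletion u) x y) adj_union_graph /=.
  rewrite -{1}(enum_valK x) -{1}(enum_valK y).
  case: (enum_val x) (enum_val y) => [[i a]|b1] [[j c]|b2] //=; rewrite ?andbF //.
    rewrite andb_idl // => _; apply/negP => /eqP eq_e.
    have := set21 (enum_rank (inl (i, a) : union_vertex)) (enum_rank (inl (j, c) : union_vertex)).
    by rewrite eq_e !inE !(inj_eq enum_rank_inj).
  case: (eqVneq b1 b2) => [_|nb]; first by rewrite andbF.
  suff -> : [set enum_rank (inr b1 : union_vertex); enum_rank (inr b2 : union_vertex)] =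
    [set extra false; extra true] by rewrite eqxx.
  by case: b1 b2 nb => [] [] // _; rewrite setUC.
rewrite /adj inE imsetU1 imset_set1.
exact: adj_union_graph.
Qed.

Lemma modified_val_onto lm u i a : exists x, @modified_val lm u x = inl (i, a).
Proof.
case: lm => /=; first by exists (enum_rank (inl (i, a) : union_vertex)); rewrite enum_rankK.
case: (unliftP (extra false) (enum_rank (inl (i, a) : union_vertex))) => [x Ex|].
  by exists x; rewrite -Ex enum_rankK.
by move/enum_rank_inj.
Qed.

(** A positive [k] keeps the path off the isolated vertices, and edges of the union do not leave a
    block. On the right [s] is measured in vertices, hence the strict inequality. *)
Lemma modified_graph_yes lm u : 0 < k ->
  (lp_yes (modified_graph lm u, k) <->
   exists i : 'I_t, exists2 s, simple_path (e (block u i)) s & k < size s).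
Proof.
move=> k_gt0; have h_inj := @modified_val_inj lm u.
split=> [[s /andP[sP ks]]|[i [s sP ks]]].
  case: s sP ks => // x s /andP[x_s uniq_s]; rewrite /path_length /= => ks.
  have follow i a y s' : modified_val y = inl (i, a) ->
      path (@adj (modified_graph lm u)) y s' -> exists2 q,
      map (@modified_val lm u) s' = [seq inl (i, b) | b <- q] & path (e (block u i)) a q.
    elim: s' a y => [|z s' IHs'] a y Ey /=; first by exists [::].
    case/andP; rewrite adj_modified_graph Ey.
    case Ez: (modified_val z) => [[j b]|b] //= /andP[/eqP eq_ij eab].
    subst j => /(IHs' _ _ Ez)[q eq_q q_path].
    by exists (b :: q); rewrite /= ?eq_q ?eab.
  have [i [a Ex]] : exists i a, modified_val x = inl (i, a).
    case: s x_s ks {uniq_s} => [|y s]; first by case: k k_gt0.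
    rewrite /= adj_modified_graph => /andP[+ _] _.
    case: (modified_val x) => [[i a]|b1]; first by exists i, a.
    by case: (modified_val y) => [[j c]|b2].
  have [q eq_q q_path] := follow i a x s Ex x_s; exists i, (a :: q).
    apply/andP; split=> //.
    rewrite -(map_inj_uniq (f := fun b => inl (i, b) : union_vertex)); last by move=> b c [].
    by rewrite -(map_inj_uniq h_inj) map_cons Ex eq_q in uniq_s.
  by rewrite /= -(size_map (fun b => inl (i, b) : union_vertex)) -eq_q size_map.
have /functional_choice[g gK] := @modified_val_onto lm u i.
have g_inj : injective g by move=> a b eq_g; have := gK a; rewrite eq_g gK => -[].
exists (map g s); rewrite /lp_solution /path_length size_map.
case: s sP ks => // a s /andP[s_path uniq_s] ks; apply/andP; split; last exact: ks.
apply/andP; split; last by rewrite (map_inj_uniq g_inj).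
elim: s a s_path {uniq_s ks} => //= b s IHs a /andP[eab /IHs->].
by rewrite adj_modified_graph !gK /= eqxx eab.
Qed.

Lemma union_solution lm u :
  correct_answer 0 (Some [:: extra false] : option (seq 'I_(nverts (union_graph lm u)))).
Proof. by []. Qed.

Definition union_instance (lm : modification) (u : bits) : reopt_instance lm :=
  @ReoptInstance lm (union_graph lm u) 0 (Some [:: extra false]) (modified_graph lm u) k
    (union_solution lm u) (union_graph_modified lm u) (leq0n k).

Hypothesis e_proj : forall a b, projection_bit n (fun x => e x a b).

Lemma union_edge_projection b x y : projection_bit (t * n) (fun u => union_edge b u x y).
Proof.
case: x y => [[i a]|b1] [[j c]|b2] /=; try exact: projection_bit_const.
case: eqVneq => [_|_] /=; last exact: projection_bit_const.
have [[c'|[d c']] [ld eq_l]] := e_proj a c; first by exists (inl c'); split=> // u; rewrite eq_l.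
exists (inr (i * n + d, c')); split=> [|u] /=.
  have {}ld : d < n by []; have := ltn_ord i; nia.
by rewrite eq_l /= nth_take // nth_drop.
Qed.

Lemma union_instance_projection lm :
  projection (t * n) (fun u => enc_reopt (union_instance lm u)).
Proof.
have sol : projection (t * n) (fun u => enc_solution (old_solution (union_instance lm u))).
  exact: (projection_const _ (@enc_solution #|union_vertex| (Some [:: extra false]))).
have graph_proj N (A : bits -> rel 'I_N) k' :
    (forall x y, projection_bit (t * n) (fun u => A u x y)) -> projection (t * n) (fun u =>
      (enc_nat N ++ [seq A u x y | x <- enum 'I_N, y <- enum 'I_N]) ++ enc_nat k').
  move=> Abit; apply: projection_cat; last exact: projection_const.
  by apply: projection_cat; [apply: projection_const | apply: projection_matrix].
apply: projection_cat.
  apply: (graph_proj #|union_vertex| (fun u => @adj (union_graph lm u)) 0) => x y.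
  apply: projection_bit_ext
    (union_edge_projection (is_edge_deletion lm) (enum_val x) (enum_val y)) => u.
  by rewrite adj_union_graph.
apply: projection_cat; first exact: sol.
case: lm {sol}.
  apply: (graph_proj _ (fun u => @adj (modified_graph EdgeDeletion u)) k) => x y.
  (* The value of [modified_val] is the same for all words; [[::]] is an arbitrary one. *)
  apply: projection_bit_ext (union_edge_projection false
    (@modified_val EdgeDeletion [::] x) (@modified_val EdgeDeletion [::] y)) => u.
  by rewrite adj_modified_graph.
apply: (graph_proj #|union_vertex|.-1 (fun u => @adj (modified_graph VertexDeletion u)) k) => x y.
apply: projection_bit_ext (union_edge_projection false
  (@modified_val VertexDeletion [::] x) (@modified_val VertexDeletion [::] y)) => u.
by rewrite adj_modified_graph.
Qed.

Lemma size_enc_lp G k' : size (enc_lp (G, k')) = (nverts G).+1 + nverts G ^ 2 + k'.+1.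
Proof.
rewrite !size_cat !size_rcons !size_nseq size_allpairs.
by rewrite -cardE card_ord mulnn.
Qed.

Lemma size_union_instance lm u :
  size (enc_reopt (union_instance lm u)) <=
  2 * #|union_vertex| ^ 2 + 3 * #|union_vertex| + k + 10.
Proof.
have -> : size (enc_reopt (union_instance lm u)) =
    size (enc_lp (union_graph lm u, 0)) +
    (size (enc_solution (Some [:: extra false])) + size (enc_lp (modified_graph lm u, k))).
  by rewrite -!size_cat.
rewrite !size_enc_lp nverts_modified_graph /= cats0 /enc_nat size_rcons size_nseq -/union_vertex.
have leN : modified_nverts lm <= #|union_vertex|.
  by rewrite /modified_nverts; case: ifP => // _; apply: leq_pred.
have : modified_nverts lm ^ 2 <= #|union_vertex| ^ 2 by rewrite leq_sqr.
have := ltn_ord (extra false).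
move: #|union_vertex| (modified_nverts lm) (nat_of_ord _) leN => N N' x; lia.
Qed.

End Composition.

(** * From a kernel to small CNFs for the complement *)

Lemma enc_nat_inj (a b : nat) (s s' : bits) :
  enc_nat a ++ s = enc_nat b ++ s' -> a = b /\ s = s'.
Proof.
rewrite /enc_nat !cat_rcons; elim: a b => [|a IHa] [|b] //=; first by case.
by case=> /IHa[-> ->].
Qed.

Lemma allpairs_inj (S T : eqType) (f g : S -> T -> bool) (s : seq S) (r : seq T) :
  [seq f x y | x <- s, y <- r] = [seq g x y | x <- s, y <- r] ->
  forall x y, x \in s -> y \in r -> f x y = g x y.
Proof.
elim: s => //= x s IHs /eqP; rewrite eqseq_cat ?size_map // => /andP[/eqP eq_x /eqP/IHs{}IHs].
move=> x' y; rewrite inE => /orP[/eqP->|]; last exact: IHs.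
by move: y; apply/eq_in_map.
Qed.

(** Certificates compare kernels as words; a code determines the number of vertices, the adjacency
    and the parameter, hence the answer. *)
Lemma enc_lp_yes (I J : lp_instance) : enc_lp I = enc_lp J -> lp_yes I -> lp_yes J.
Proof.
case: I J => [[N E E2] k] [[N' E' E2'] k']; rewrite /enc_lp /enc_graph /= -!catA.
case/enc_nat_inj => eqN; subst N' => /eqP.
rewrite eqseq_cat; last by rewrite !size_allpairs.
case/andP => /eqP eq_adj /eqP; rewrite -[enc_nat k]cats0 -[enc_nat k']cats0.
case/enc_nat_inj => eq_k _ [s /andP[sP ks]]; exists s.
have {}eq_adj x y : @adj (Graph E2) x y = @adj (Graph E2') x y.
  by apply: (allpairs_inj eq_adj); rewrite mem_enum.
rewrite /lp_solution -eq_k ks andbT; case: s sP {ks} => //= x s /andP[x_s ->].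
by rewrite andbT -(eq_path eq_adj).
Qed.

(** A tableau has an input of fixed length, whence the disjunction over the lengths of the NP
    witness. *)
Lemma cnf_def_NP (L : language) : NP L ->
  exists2 B, poly_bounded B & forall n, cnf_def n (B n) L.
Proof.
move=> [R [p [[M [pM RM]] LR]]].
(* The base of the square adds the length of the encoded pair, the running time, the output length 1
   and the 1 in the tableau's window; the last summand pays for the witness bits. *)
pose B1 n := tableau_const M *
  (2 * n + 1 + p.[n] + pM.[2 * n + 1 + p.[n]] + 1 + 1)%R ^ 2 + (p.[n])%R.
exists (fun n => ((p.[n])%R.+1 + 1) * (3 * B1 n + 3)); first by rewrite /B1; poly_bound.
move=> n; pose lits l : seq plit := flatten [seq [:: inl true; inr (e, false)] | e <- iota 0 n] ++
  inl false :: [seq inr (n + e, false) | e <- iota 0 l].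
have size_lits l : size (lits l) = 2 * n + 1 + l.
  rewrite size_cat /= size_map size_iota -addn1 addnA addnAC; congr (_ + _ + _).
  by rewrite -[in RHS](size_iota 0 n); elim: (iota 0 n) => //= e s ->; lia.
have litsP l : all (plit_bounded (n + l)) (lits l).
  rewrite all_cat /=; apply/andP; split; last first.
    by rewrite all_map; apply/allP => e; rewrite mem_iota /= ltn_add2l.
  apply/allP => q /flattenP[_ /mapP[e + ->]]; rewrite mem_iota /= !inE => lte.
  by case/orP => /eqP-> //=; lia.
have lits_val l x w : size x = n -> size w = l ->
    [seq plit_val (x ++ w) q | q <- lits l] = enc_pair (x, w).
  move=> szx szw; rewrite map_cat /enc_pair /=; congr (_ ++ _ :: _).
    rewrite map_flatten -map_comp -{2}(mkseq_nth false x) szx /mkseq -map_comp.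
    congr flatten; apply/eq_in_map => e; rewrite mem_iota /= => lte.
    by rewrite nth_cat szx lte addbF.
  rewrite -map_comp -[RHS](mkseq_nth false) szw; apply: eq_map => e /=.
  by rewrite nth_cat szx ltnNge leq_addr /= addKn addbF.
have ldef l : l < (p.[n])%R.+1 -> cnf_def n (B1 n) (fun x => exists2 w, size w = l &
    tm_output (iter (pM.[size (lits l)])%R (@tm_step M)
      (tm_init M [seq plit_val (x ++ w) q | q <- lits l])) = [:: true]).
  move=> ltl; have := cnf_def_ex (cnf_def_tableau M (pM.[size (lits l)])%R [:: true] (litsP l)).
  apply: cnf_def_le; rewrite size_lits /B1 leq_add // leq_mul2l; apply/orP; right.
  rewrite leq_sqr !leq_add2r; apply: leq_add; first by rewrite leq_add2l.
  by apply: leq_horner; rewrite leq_add2l.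
apply: cnf_def_iff (cnf_def_exists_lt ldef) => x szx; rewrite LR szx.
have out l w : size w = l -> (tm_output (iter (pM.[size (lits l)])%R (@tm_step M)
      (tm_init M [seq plit_val (x ++ w) q | q <- lits l])) = [:: true]) <-> R (x, w).
  move=> szw; have [_] := RM (x, w); rewrite -(lits_val l) // size_map => ->.
  by rewrite /enc_bool; split=> [[]|->].
split=> [[l ltl [w szw /(out _ _ szw) Rw]]|[w [lew Rw]]].
  by exists w; rewrite szw.
by exists (size w) => //; exists w => //; apply/out.
Qed.

(* [rcons b true] makes the padding with [false] injective on words of length at
   most [m]. *)
Definition pad (m : nat) (b : bits) : m.+1.-tuple bool :=
  [tuple nth false (rcons b true) i | i < m.+1].

Lemma pad_inj (m : nat) (b b' : bits) :
  size b <= m -> size b' <= m -> pad m b = pad m b' -> b = b'.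
Proof.
move=> szb szb' eq_pad.
have nth_eq i : i <= m -> nth false (rcons b true) i = nth false (rcons b' true) i.
  move=> lei; have := congr1 (fun s => tnth s (Ordinal (lei : i < m.+1))) eq_pad.
  by rewrite !tnth_mktuple.
have size_le c c' : size c' <= m ->
    (forall i, i <= m -> nth false (rcons c true) i = nth false (rcons c' true) i) ->
    size c' <= size c.
  move=> lec' /(_ _ lec'); rewrite !nth_rcons ltnn eqxx.
  by case: (ltngtP (size c') (size c)).
have eq_size : size b = size b'.
  by apply/eqP; rewrite eqn_leq !size_le // => i /nth_eq.
apply: (@eq_from_nth _ false) => // i lti; have := nth_eq i (leq_trans (ltnW lti) szb).
by rewrite !nth_rcons -eq_size lti.
Qed.

(** * Substituting a word for one block of a concatenation *)

Section Words.

Variables (t0 n : nat).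
Local Notation t := t0.+1.

Definition insert (i : nat) (x w : bits) : bits :=
  mkseq (fun q => if q %/ n == i then nth false x (q %% n) else nth false w q) (t * n).

(** Redirecting indices absorbs the insertion into the literals: with variables [x ++ w], block [i]
    is read from [x] and every other bit from [w]. *)
Definition insert_lit (i : nat) (l : plit) : plit :=
  match l with
  | inl b => inl b
  | inr (q, b) => inr (if q %/ n == i then q %% n else n + q, b)
  end.

Definition word (z : {ffun 'I_t -> n.-tuple bool}) : bits :=
  mkseq (fun q => nth false (z (inord (q %/ n))) (q %% n)) (t * n).

Lemma insert_lit_bounded i l : plit_bounded (t * n) l ->
  plit_bounded (n + t * n) (insert_lit i l).
Proof.
case: l => [//|[q b]] /= ltq; case: ifP => _; last by rewrite ltn_add2l.
by apply: ltn_addr; apply: ltn_pmod; case: n ltq => //; rewrite muln0.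
Qed.

Lemma insert_lit_val i l x w : size x = n -> plit_bounded (t * n) l ->
  plit_val (x ++ w) (insert_lit i l) = plit_val (insert i x w) l.
Proof.
move=> szx; case: l => [//|[q b]] /= ltq; congr (_ (+) _).
rewrite nth_mkseq //; case: ifP => _; rewrite nth_cat szx.
  by rewrite ltn_pmod //; case: n ltq => //; rewrite muln0.
by rewrite ltnNge leq_addr /= addKn.
Qed.

Let block_nth i u d : d < n -> nth false (block n u i) d = nth false u (i * n + d).
Proof. by move=> ltd; rewrite nth_take // nth_drop. Qed.

Lemma size_block i u : i < t -> size u = t * n -> size (block n u i) = n.
Proof.
by move=> lti szu; rewrite size_take size_drop szu; case: ltnP; nia.
Qed.

Let divmod i d : i < t -> d < n ->
  [/\ i * n + d < t * n, (i * n + d) %/ n = i & (i * n + d) %% n = d].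
Proof.
move=> lti ltd; split; first nia.
  by rewrite divnMDl ?divn_small ?addn0 //; lia.
by rewrite modnMDl modn_small.
Qed.

Lemma block_insert i x w : i < t -> size x = n -> block n (insert i x w) i = x.
Proof.
move=> lti szx; apply: (@eq_from_nth _ false).
  by rewrite szx size_block // size_mkseq.
rewrite size_block ?size_mkseq // => d ltd; have [lt Ed Em] := divmod lti ltd.
by rewrite block_nth // nth_mkseq // Ed Em eqxx.
Qed.

Lemma block_word (z : {ffun 'I_t -> n.-tuple bool}) (i : 'I_t) :
  block n (word z) i = z i.
Proof.
apply: (@eq_from_nth _ false); first by rewrite size_tuple size_block // size_mkseq.
rewrite size_block ?size_mkseq // => d ltd; have [lt Ed Em] := divmod (ltn_ord i) ltd.
by rewrite block_nth // nth_mkseq // Ed Em inord_val.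
Qed.

Lemma insert_word (z : {ffun 'I_t -> n.-tuple bool}) (i : 'I_t) :
  insert i (z i) (word z) = word z.
Proof.
apply: (@eq_from_nth _ false); rewrite !size_mkseq // => q ltq.
by rewrite !nth_mkseq //; case: eqP => // ->; rewrite inord_val.
Qed.

End Words.

(** * Certificates of non-membership obtained from a kernel *)

Section Kernel.

Variables (lm : modification) (K : reopt_instance lm -> lp_instance) (q : {poly nat}).
Variables (MK : tm) (pK : {poly nat}).
Hypothesis MKP : forall I : reopt_instance lm,
  let c := iter (pK.[size (enc_reopt I)])%R (@tm_step MK) (tm_init MK (enc_reopt I)) in
  tm_halted c /\ tm_output c = enc_lp (K I).
Hypothesis K_yes : forall I, lp_yes (K I) <-> reopt_yes I.
Hypothesis K_size : forall I, size (enc_lp (K I)) <= (q.[new_param I])%R.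

Variables (L : language) (n r B : nat) (f : cnf).
Hypotheses (rB : r + cnf_size f <= B) (fb : cnf_bounded (n + r) f).
Hypothesis Lf : forall x, size x = n -> (L x <-> exists2 w, size w = r & sat (x ++ w) f).

(** The number of edges of a Hamiltonian path of one component. *)
Let k := #|cnf_vertex n r f|.-1.
Let m := (q.[k])%R.

Let inst (u : bits) : reopt_instance lm :=
  @union_instance m.+1 n _ (@cnf_edge n r f) k (@cnf_edge_irr n r f) lm u.

Let out (u : bits) : bits := enc_lp (K (inst u)).

Let size_out u : size (out u) <= m.
Proof. exact: K_size. Qed.

Let out_yes u : size u = m.+1 * n ->
  (lp_yes (K (inst u)) <-> exists i : 'I_m.+1, L (block n u i)).
Proof.
move=> szu; rewrite K_yes /reopt_yes.
have Wk : #|cnf_vertex n r f| = k.+1 by rewrite prednK // card_cnf_vertex.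
have k_gt0 : 0 < k by rewrite /k card_cnf_vertex; lia.
rewrite (@modified_graph_yes m.+1 n _ (@cnf_edge n r f) k (@cnf_edge_sym n r f)
  (@cnf_edge_irr n r f) lm u k_gt0).
have szb (i : 'I_m.+1) : size (block n u i) = n.
  exact: size_block (ltn_ord i) szu.
split=> -[i Hi]; exists i.
  by rewrite Lf // -(cnf_graph_path fb) // Wk.
by move: Hi; rewrite Lf // -(cnf_graph_path fb) // Wk.
Qed.

(** These bounds replace [r] and [size f] by [B], so that they become polynomial in [n] once [B]
    is. *)
Definition vertex_bound : nat := 3 * ((n + B).+2 + (n + B).+1 * (3 * (B + n) + 2).+1 + (B + n)).
Definition out_bound : nat := (q.[vertex_bound])%R.
Definition union_bound : nat := out_bound.+1 * vertex_bound + 2.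
Definition instance_bound : nat := 2 * union_bound ^ 2 + 3 * union_bound + vertex_bound + 10.
Definition branch_bound : nat :=
  tableau_const MK * (instance_bound + (pK.[instance_bound])%R + out_bound + 1) ^ 2
  + out_bound.+1 * n.

Let le_vertex : #|cnf_vertex n r f| <= vertex_bound.
Proof.
have szf : size f <= cnf_size f.
  by rewrite /cnf_size; elim: (f) => //= c g IHg; rewrite addSn ltnS (leq_trans IHg) ?leq_addl.
rewrite card_cnf_vertex /vertex_bound leq_mul2l /=; apply: leq_add; last by lia.
by apply: leq_add; [lia | apply: leq_mul; lia].
Qed.

Let le_out : m <= out_bound.
Proof. by apply: leq_horner; apply: leq_trans le_vertex; apply: leq_pred. Qed.

Let le_instance u : size (enc_reopt (inst u)) <= instance_bound.
Proof.
apply: leq_trans (size_union_instance _ _ _ _ _ _) _.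
have : #|union_vertex m.+1 (cnf_vertex n r f)| <= union_bound.
  rewrite card_sum card_prod card_ord card_bool leq_add2r leq_mul //.
move=> leV; have : #|union_vertex m.+1 (cnf_vertex n r f)| ^ 2 <= union_bound ^ 2.
  by rewrite leq_sqr.
have := le_vertex; rewrite /instance_bound /k; lia.
Qed.

Let branch (i : nat) (y : bits) : size y <= m -> cnf_def n branch_bound
  (fun x => exists2 w, size w = m.+1 * n & out (insert m n i x w) = y).
Proof.
move=> szy; have [lits [litsP litsE]] := @union_instance_projection m.+1 n
  _ _ k (@cnf_edge_sym n r f) (@cnf_edge_irr n r f) (@cnf_edge_projection n r f) lm.
have litsP' : all (plit_bounded (n + m.+1 * n)) [seq insert_lit n i l | l <- lits].
  by rewrite all_map; apply: sub_all litsP => l /(@insert_lit_bounded m n i).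
have sz_lits u : size (enc_reopt (inst u)) = size lits by rewrite /inst litsE size_map.
have le_B : tableau_const MK * (size [seq insert_lit n i l | l <- lits] +
    (pK.[size lits])%R + size y + 1) ^ 2 + m.+1 * n <= branch_bound.
  rewrite size_map; apply: leq_add; last by rewrite leq_mul2r ltnS le_out orbT.
  rewrite leq_mul2l; apply/orP; right; rewrite leq_sqr leq_add2r.
  have le_lits : size lits <= instance_bound by rewrite -(sz_lits [::]).
  apply: leq_add; last exact: leq_trans szy le_out.
  by apply: leq_add => //; apply: leq_horner.
have := cnf_def_le le_B (cnf_def_ex (cnf_def_tableau MK (pK.[size lits])%R y litsP')).
apply: cnf_def_iff => x szx.
suff eq_out w : tm_output (iter (pK.[size lits])%R (@tm_step MK) (tm_init MK
    [seq plit_val (x ++ w) l | l <- [seq insert_lit n i l | l <- lits]])) =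
    out (insert m n i x w).
  by split=> -[w szw]; [rewrite eq_out | rewrite -eq_out] => outw; exists w.
have [_] := MKP (inst (insert m n i x w)); rewrite sz_lits => outE.
rewrite [RHS](esym outE).
congr (tm_output (iter _ _ (tm_init MK _))); rewrite /inst litsE -map_comp.
by apply/eq_in_map => l /(allP litsP); apply: insert_lit_val.
Qed.

Lemma cnf_def_complement :
  cnf_def n ((n.+1 + 1) * (3 * branch_bound + 3)) (fun x => ~ L x).
Proof.
(* Membership in [L] is turned into a boolean by classical choice, as the covering counts a finite
   set. *)
have [inS SP] : exists inS : n.-tuple bool -> bool, forall x, inS x <-> ~ L x.
  apply: (functional_choice (fun (x : n.-tuple bool) (b : bool) => b <-> ~ L x)) => x.
  by case: (classic (L x)) => Lx; [exists false | exists true].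
pose S := [set x | inS x].
pose F (z : {ffun 'I_m.+1 -> n.-tuple bool}) := pad m (out (word z)).
have [|||A [szA An0 Acover]] := @distillation_cover _ _ m.+1 F S _ _ n.+1 S (subxx _).
- by [].
- by rewrite card_tuple card_bool.
- by rewrite (leq_ltn_trans (max_card _)) // card_tuple card_bool ltn_exp2l.
(* Padded values have the cardinality required for distillation; the tableau needs the original
   output word, recovered here from some tuple with this value. *)
pose y_of (y : m.+1.-tuple bool) : bits :=
  if [pick z | F z == y] is Some z then out (word z) else [::].
have y_ofP z : y_of (F z) = out (word z).
  rewrite /y_of; case: pickP => [z' /eqP|/(_ z)]; last by rewrite eqxx.
  by apply: pad_inj.
have size_y y : size (y_of y) <= m by rewrite /y_of; case: pickP.
have szw (z : {ffun 'I_m.+1 -> n.-tuple bool}) : size (word z) = m.+1 * n.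
  by rewrite size_mkseq.
pose P j x := exists2 w, size w = m.+1 * n &
  out (insert m n (nth (ord0, F [ffun=> [tuple of nseq n false]]) A j).1 x w) =
  y_of (nth (ord0, F [ffun=> [tuple of nseq n false]]) A j).2.
have Pdef j : j < size A -> cnf_def n branch_bound (P j) by move=> _; apply: branch.
apply: cnf_def_le (cnf_def_iff _ (cnf_def_exists_lt Pdef)).
  by rewrite leq_mul2r leq_add2r szA orbT.
move=> x szx; split=> [[j ltj [w wsz out_w]] Lx|nLx].
  (* Soundness: the nonempty fiber provides words outside [L] with this kernel, while [x] in [L]
     would make the same code that of a yes-instance. *)
  move: (mem_nth (ord0, F [ffun=> [tuple of nseq n false]]) ltj) out_w.
  case: nth => i y /= /An0/set0Pn[x' /fiberP[z [zS _ <-]]]; rewrite y_ofP => out_w.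
  have : lp_yes (K (inst (word z))).
    apply: (enc_lp_yes out_w); apply/out_yes; first by rewrite size_mkseq.
    by exists i; rewrite block_insert.
  case/(out_yes (szw z)) => j'; rewrite block_word.
  by have := zS j'; rewrite inE => /SP.
have [|[i y] iyA /fiberP[z [zS zi Fz]]] := Acover (Tuple (introT eqP szx)).
  by rewrite inE; apply/SP.
exists (index (i, y) A); first by rewrite index_mem.
(* The covering tuple is the guess: inserting [x] where it already stands changes nothing. *)
exists (word z); first exact: szw.
rewrite /= in zi Fz; rewrite nth_index //= -Fz y_ofP.
by have := insert_word z i; rewrite zi => ->.
Qed.

End Kernel.

Lemma poly_bounded_branch (q pK : {poly nat}) (MK : tm) (B : nat -> nat) :
  poly_bounded B -> poly_bounded (fun n => branch_bound q MK pK n (B n)).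
Proof.
move=> Bpoly.
have vertex_poly : poly_bounded (fun n => vertex_bound n (B n)).
  by rewrite /vertex_bound; poly_bound.
have out_poly : poly_bounded (fun n => out_bound q n (B n)).
  exact: poly_bounded_horner vertex_poly.
have union_poly : poly_bounded (fun n => union_bound q n (B n)).
  apply: poly_bounded_add (poly_bounded_const _).
  exact: poly_bounded_mul (poly_bounded_succ out_poly) vertex_poly.
have instance_poly : poly_bounded (fun n => instance_bound q n (B n)).
  apply: poly_bounded_add (poly_bounded_const _); apply: poly_bounded_add vertex_poly.
  apply: poly_bounded_add (poly_bounded_mul (poly_bounded_const _) union_poly).
  exact: poly_bounded_mul (poly_bounded_const _) (poly_bounded_exp _ union_poly).
have run_poly := poly_bounded_horner pK instance_poly.
apply: poly_bounded_add; last first.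
  exact: poly_bounded_mul (poly_bounded_succ out_poly) poly_bounded_id.
apply: poly_bounded_mul (poly_bounded_const _) _; apply: poly_bounded_exp.
apply: poly_bounded_add (poly_bounded_const _); apply: poly_bounded_add out_poly.
exact: poly_bounded_add instance_poly run_poly.
Qed.

Lemma kernel_coNP_poly (lm : modification) :
  has_poly_kernel lm -> forall L : language, NP L -> coNP_poly L.
Proof.
move=> [K [q [[MK [pK MKP]] KP]]] L /cnf_def_NP[B Bpoly Ldef].
apply: (@coNP_poly_of_cnf _
  (fun n => (n.+1 + 1) * (3 * branch_bound q MK pK n (B n) + 3))) => [|n].
  apply: poly_bounded_mul.
    exact: poly_bounded_add (poly_bounded_succ poly_bounded_id) (poly_bounded_const 1).
  apply: poly_bounded_add (poly_bounded_const 3).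
  exact: poly_bounded_mul (poly_bounded_const 3) (poly_bounded_branch _ _ _ Bpoly).
have [r [f [rB fb Lf]]] := Ldef n.
apply: (cnf_def_complement MKP _ _ rB fb Lf) => I; by case: (KP I).
Qed.

Theorem theorem9 :
  ~ (forall L : language, NP L -> coNP_poly L) ->
  ~ has_poly_kernel EdgeDeletion /\ ~ has_poly_kernel VertexDeletion.
Proof.
by move=> NP_sep; split=> /kernel_coNP_poly NP_incl; apply: NP_sep.
Qed.
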